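(* Let the Finsler manifolds $(M,L)$ and $(M,\tilde L)$ be conformal with $\tilde g=e^{2\sigma(x)}g$. Assume that the $\pi$-tensor field $H$ is traceless: $\mathrm{Tr}(H)=0$. Then the following geometric objects (associated with the Cartan connection) are conformally invariant: (a) The horizontal Ricci tensor $Ric^h$. (b) The scalar function $L^2Sc^h$. (c) The $\pi$-tensor field $\mathbb F^h:=Ric^h-\dfrac{Sc^h\,g}{2(n-1)}$ (for $n\ne1$). (d) The horizontal Einstein $\pi$-tensor field $E^h:=Ric^h-\dfrac{Sc^h}{2}g$.
   Context: $M$ is a smooth manifold of finite dimension $n$; $\mathcal T M\subset TM$ is the bundle of nonzero tangent vectors, $\pi:\mathcal TM\to M$; $\pi^{-1}(TM)\to\mathcal TM$ is the pullback of $TM$ by $\pi$; its smooth sections are the $\pi$-vector fields; $\pi$-tensor fields are tensor fields on this bundle. $\overline\eta(u)=(u,u)$. $\gamma:\pi^{-1}(TM)\to T(\mathcal TM)$ is the vertical lift, $\rho:T(\mathcal TM)\to\pi^{-1}(TM)$ is $\rho=(\pi_{\mathcal TM},d\pi)$; $\mathcal C:=\gamma\circ\overline\eta$. For a linear connection $\nabla$ in $\pi^{-1}(TM)$ the deflection map is $K(X)=\nabla_X\overline\eta$; $\nabla$ is regular if $T(\mathcal TM)=\ker\rho\oplus\ker K$; then $\beta:=(\rho|_{\ker K})^{-1}$. Torsion: $\mathbf T(X,Y)=\nabla_X\rho Y-\nabla_Y\rho X-\rho[X,Y]$, $Q(\overline X,\overline Y)=\mathbf T(\beta\overline X,\beta\overline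 Y)$, $T(\overline X,\overline Y)=\mathbf T(\gamma\overline X,\beta\overline Y)$. Curvature: $\mathbf K(X,Y)\overline Z=-\nabla_X\nabla_Y\overline Z+\nabla_Y\nabla_X\overline Z+\nabla_{[X,Y]}\overline Z$; $R(\overline X,\overline Y)\overline Z=\mathbf K(\beta\overline X,\beta\overline Y)\overline Z$, $P(\overline X,\overline Y)\overline Z=\mathbf K(\beta\overline X,\gamma\overline Y)\overline Z$, $S(\overline X,\overline Y)\overline Z=\mathbf K(\gamma\overline X,\gamma\overline Y)\overline Z$. A Finsler manifold $(M,L)$: $L:TM\to\mathbb R$, $L\ge0$, $L(0)=0$, $L$ is $C^\infty$ on $\mathcal TM$, $C^1$ on $TM$, $\mathcal C\cdot L=L$, and $g$ with components $g_{ij}=\frac12\dot\partial_i\dot\partial_jL^2$ ($\dot\partial_i=\partial/\partial y^i$) is positive definite; $g$ is a metric in $\pi^{-1}(TM)$. The Cartan connection of $(M,L)$ is the unique regular connection with $\nabla g=0$, $Q=0$, $g(T(\overline X,\overline Y),\overline Z)=g(T(\overline X,\overline Z),\overline Y)$. For it: $Ric^h(\overline X,\overline Y)$ is the trace of $\overline Z\mapsto R(\overline X,\overline Z)\overline Y$; $Ric_0^h$ is defined by $g(Ric_0^h(\overline X),\overline Y)=Ric^h(\overline X,\overline Y)$; $Sc^h:=\mathrm{Tr}(Ric_0^h)$. $\sigma$ is a smooth function on $M$. Objects with tilde are those of $(M,\tilde L)$ (with $\tilde R$ formed using $\tilde\beta$). Put $\omega(X,\overline Y):=\tilde\nabla_X\overline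 Y-\nabla_X\overline Y$, $B(\overline X,\overline Y):=\omega(\beta\overline X,\overline Y)$, $N(\overline X):=B(\overline X,\overline\eta)$, $\mathcal L:=\gamma\circ N\circ\rho$, $\mathfrak U_{\overline X,\overline Y}\Theta(\overline X,\overline Y)=\Theta(\overline X,\overline Y)-\Theta(\overline Y,\overline X)$, and $$\begin{aligned}H(\overline X,\overline Y)\overline Z=\ &S(N\overline X,N\overline Y)\overline Z-\mathfrak U_{\overline X,\overline Y}\{P(\overline X,N\overline Y)\overline Z+(\nabla_{\beta\overline X}B)(\overline Y,\overline Z)\\&-(\nabla_{\mathcal L\beta\overline X}B)(\overline Y,\overline Z)+B(\overline X,B(\overline Y,\overline Z))-B(T(N\overline X,\overline Y),\overline Z)\}.\end{aligned}$$ (It satisfies $\tilde R=R+H$.) $\mathrm{Tr}(H)=0$ means that for all $\overline X,\overline Y$ the trace of $\overline Z\mapsto H(\overline X,\overline Z)\overline Y$ is zero. An object $W$ attached to $(M,L)$ is conformally invariant if $\tilde W=W$. *)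

(* Defs.v *)
From HB Require Import structures.
From mathcomp Require Import all_boot all_order all_algebra.
From mathcomp Require Import all_classical all_reals all_analysis.

Set Implicit Arguments.
Unset Strict Implicit.
Unset Printing Implicit Defensive.

Import Order.TTheory GRing.Theory Num.Theory.
Import numFieldNormedType.Exports.
Local Open Scope classical_set_scope.
Local Open Scope ring_scope.

Section Smoothness.
Context {R : realType} {V W : normedModType R}.

Fixpoint iterD (vs : seq V) (f : V -> W) : V -> W :=
  if vs is v :: vs' then 'D_v (iterD vs' f) else f.

(* [f] is C^oo on a neighbourhood of [z] (for finite-dimensional [V]): all
   iterated directional derivatives exist and are continuous there. *)
Definition smooth_at (f : V -> W) (z : V) : Prop :=
  \forall a \near z, forall vs : seq V,
    {for a, continuous (iterD vs f)} /\
    forall v, derivable (iterD vs f) a v.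

Definition C1_at (f : V -> W) (z : V) : Prop :=
  \forall a \near z, {for a, continuous f} /\
    forall v, derivable f a v /\ {for a, continuous ('D_v f)}.

End Smoothness.

(* The atlas is indexed by the points of the manifold, [chart x] being a chart
   around [x]; any atlas can be presented in this way.  [chart x] and
   [chart_inv x] are total functions, meaningful on [dom x] and on
   [chart x @` dom x] respectively. *)
Record smooth_manifold (R : realType) (n : nat) := SmoothManifold {
  carrier :> topologicalType;
  manifold_hausdorff : hausdorff_space carrier;
  manifold_second_countable : @second_countable carrier;
  dom : carrier -> set carrier;
  chart : carrier -> carrier -> 'rV[R]_n;
  chart_inv : carrier -> 'rV[R]_n -> carrier;
  dom_open : forall x, open (dom x);
  mem_dom : forall x, dom x x;
  chart_image_open : forall x, open (chart x @` dom x);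
  chartK : forall x p, dom x p -> chart_inv x (chart x p) = p;
  chart_continuous : forall x p, dom x p -> {for p, continuous (chart x)};
  chart_inv_continuous : forall x p, dom x p ->
    {for chart x p, continuous (chart_inv x)};
  transition_smooth : forall x y p, dom x p -> dom y p ->
    smooth_at (chart y \o chart_inv x) (chart x p) }.

Section TangentBundle.
Context {R : realType} {n : nat} (M : smooth_manifold R n).
Local Notation E := 'rV[R]_n.

(* The tangent space T_x M is identified with R^n by means of [chart x], so
   that [(x, v)] is the tangent vector at [x] whose components in [chart x]
   are [v].  The bundle of nonzero vectors is the part of [TM] singled out by
   [slit]; functions and fields on it are total functions on [TM], of which
   only the values on [slit] matter. *)
Definition TM : Type := (M * E)%type.
Definition slit (u : TM) : Prop := u.2 != 0.

Definition transition (x y : M) : E -> E := chart y \o chart_inv x.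

(* T(TM) is trivialised at [u] by the bundle chart over [chart u.1]: [here u]
   are the coordinates of [u] in it, and [Tinv x] is the inverse of the bundle
   chart over [chart x]. *)
Definition here (u : TM) : E * E := (chart u.1 u.1, u.2).
Definition Tinv (x : M) (z : E * E) : TM :=
  let p := chart_inv x z.1 in (p, 'D_(z.2) (transition x p) z.1).
Definition Ttransition (x y : M) (z : E * E) : E * E :=
  (transition x y z.1, 'D_(z.2) (transition x y) z.1).

(* A vector field on TM takes at [u] the value [X u = (dx, dy)], in the bundle
   chart over [chart u.1]. *)
Definition vfield : Type := TM -> E * E.
Definition pifield : Type := TM -> E.

(* Components, in a fixed chart around [x], of (pi-)vector fields. *)
Definition pirep (x : M) (X : pifield) (z : E * E) : E :=
  let u := Tinv x z in 'D_(X u) (transition u.1 x) (chart u.1 u.1).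
Definition vrep (x : M) (X : vfield) (z : E * E) : E * E :=
  let u := Tinv x z in 'D_(X u) (Ttransition u.1 x) (here u).

(* Smoothness on a neighbourhood of [u]. *)
Definition fun_smooth (u : TM) (f : TM -> R) : Prop :=
  smooth_at (f \o Tinv u.1) (here u).
Definition pi_smooth (u : TM) (X : pifield) : Prop :=
  smooth_at (pirep u.1 X) (here u).
Definition v_smooth (u : TM) (X : vfield) : Prop :=
  smooth_at (vrep u.1 X) (here u).
Definition base_smooth (s : M -> R) : Prop :=
  forall x, smooth_at (s \o chart_inv x) (chart x x).

Definition act (u : TM) (w : E * E) (f : TM -> R) : R :=
  'D_w (f \o Tinv u.1) (here u).

Definition bracket (X Y : vfield) : vfield := fun u =>
  'D_(X u) (vrep u.1 Y) (here u) - 'D_(Y u) (vrep u.1 X) (here u).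

Definition gamma (X : pifield) : vfield := fun u => (0, X u).
Definition rho (X : vfield) : pifield := fun u => (X u).1.
Definition eta : pifield := fun u => u.2.

(* The i-th coordinate field of [chart u.1], a pi-vector field around [u]. *)
Definition frame (u : TM) (i : 'I_n) : pifield := fun u' =>
  'D_(delta_mx 0 i) (transition u.1 u'.1) (chart u.1 u'.1).

(* The trace, at [u], of the tensorial endomorphism [A]. *)
Definition Tr (A : pifield -> pifield) (u : TM) : R :=
  \sum_(i < n) A (frame u i) u 0 i.

End TangentBundle.

Arguments eta {R n M}.

(* A linear connection in the pullback bundle.  Connections are local
   operators, and are given here on local sections: [cov u w Y] is the covariant
   derivative, along the vector [w] at [u], of a section [Y] smooth around
   [u].  Locality follows from the Leibniz rule, in which [f] need only be
   smooth around [u]. *)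
Record linear_connection (R : realType) (n : nat) (M : smooth_manifold R n) :=
  LinearConnection {
  cov : TM M -> 'rV[R]_n * 'rV[R]_n -> pifield M -> 'rV[R]_n;
  cov_linear_dir : forall u a w w' Y, slit u -> pi_smooth u Y ->
    cov u (a *: w + w') Y = a *: cov u w Y + cov u w' Y;
  cov_additive : forall u w Y Z, slit u -> pi_smooth u Y -> pi_smooth u Z ->
    cov u w (fun u' => Y u' + Z u') = cov u w Y + cov u w Z;
  cov_Leibniz : forall u w f Y, slit u -> fun_smooth u f -> pi_smooth u Y ->
    cov u w (fun u' => f u' *: Y u') = act u w f *: Y u + f u *: cov u w Y;
  cov_smooth : forall u X Y, slit u -> v_smooth u X -> pi_smooth u Y ->
    pi_smooth u (fun u' => cov u' (X u') Y) }.

Section Connections.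
Context {R : realType} {n : nat} {M : smooth_manifold R n}.
Local Notation E := 'rV[R]_n.
Implicit Types (D : linear_connection M) (X Y Z : pifield M).

Definition nabla D (X : vfield M) (Y : pifield M) : pifield M :=
  fun u => cov D u (X u) Y.

Definition defl D (u : TM M) (w : E * E) : E := cov D u w eta.

Definition regular D : Prop := forall u, slit u ->
  (forall w : E * E, exists w1 w2 : E * E,
     [/\ w = w1 + w2, w1.1 = 0 & defl D u w2 = 0]) /\
  (forall w : E * E, w.1 = 0 -> defl D u w = 0 -> w = 0).

Definition beta D (X : pifield M) : vfield M := fun u =>
  xget 0 [set w : E * E | w.1 = X u /\ defl D u w = 0].

Definition torsion D (X Y : vfield M) : pifield M := fun u =>
  nabla D X (rho Y) u - nabla D Y (rho X) u - rho (bracket X Y) u.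
Definition Qtor D X Y : pifield M := torsion D (beta D X) (beta D Y).
Definition Ttor D X Y : pifield M := torsion D (gamma X) (beta D Y).

Definition curvature D (X Y : vfield M) Z : pifield M := fun u =>
  - nabla D X (nabla D Y Z) u + nabla D Y (nabla D X Z) u
  + nabla D (bracket X Y) Z u.
Definition Rcurv D X Y Z : pifield M := curvature D (beta D X) (beta D Y) Z.
Definition Pcurv D X Y Z : pifield M := curvature D (beta D X) (gamma Y) Z.
Definition Scurv D X Y Z : pifield M := curvature D (gamma X) (gamma Y) Z.

End Connections.

Section Finsler.
Context {R : realType} {n : nat} {M : smooth_manifold R n}.
Local Notation E := 'rV[R]_n.
Implicit Types (L : TM M -> R) (D : linear_connection M) (X Y Z : pifield M).

Definition gmx L (u : TM M) : 'M[R]_n := \matrix_(i, j)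
  (2^-1 * 'D_((0, delta_mx 0 i) : E * E)
            ('D_((0, delta_mx 0 j) : E * E) ((fun u' => L u' ^+ 2) \o Tinv u.1))
            (here u)).
Definition g L (u : TM M) (v w : E) : R := (v *m gmx L u *m w^T) 0 0.

(* C^1 regularity along the zero section is required of [L ^+ 2]: a
   nonnegative function that is positively homogeneous of degree one and
   differentiable at the zero vectors would vanish identically.  It is implied
   by the C^1 regularity of [L]. *)
Record finsler L : Prop := Finsler {
  finsler_ge0 : forall u, 0 <= L u;
  finsler_zero : forall x : M, L (x, 0) = 0;
  finsler_smooth : forall u, slit u -> fun_smooth u L;
  finsler_C1 : forall u, C1_at ((fun u' => L u' ^+ 2) \o Tinv u.1) (here u);
  finsler_homogeneous : forall u, slit u -> act u (gamma eta u) L = L u;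
  finsler_posdef : forall u, slit u -> forall v, v != 0 -> 0 < g L u v v }.

Record cartan L D : Prop := Cartan {
  cartan_regular : regular D;
  cartan_metric : forall u w Y Z, slit u -> pi_smooth u Y -> pi_smooth u Z ->
    act u w (fun u' => g L u' (Y u') (Z u')) -
      g L u (cov D u w Y) (Z u) - g L u (Y u) (cov D u w Z) = 0;
  cartan_Q : forall u X Y, slit u -> pi_smooth u X -> pi_smooth u Y ->
    Qtor D X Y u = 0;
  cartan_T : forall u X Y Z, slit u ->
    pi_smooth u X -> pi_smooth u Y -> pi_smooth u Z ->
    g L u (Ttor D X Y u) (Z u) = g L u (Ttor D X Z u) (Y u) }.

Definition Ric D X Y : TM M -> R := Tr (fun Z => Rcurv D X Z Y).

(* The pi-vector field with g(Ric0 X, Y) = Ric(X, Y) for all Y. *)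
Definition Ric0 L D X : pifield M := fun u =>
  xget 0 [set w : E |
    forall Y, pi_smooth u Y -> g L u w (Y u) = Ric D X Y u].

Definition Sc L D : TM M -> R := Tr (Ric0 L D).

Definition Ftens L D X Y (u : TM M) : R :=
  Ric D X Y u - Sc L D u * g L u (X u) (Y u) / (2 * (n%:R - 1)).

Definition Etens L D X Y (u : TM M) : R :=
  Ric D X Y u - Sc L D u / 2 * g L u (X u) (Y u).

(* Equality of scalar pi-tensor fields of type (0, 2). *)
Definition tensor_eq (A B : pifield M -> pifield M -> TM M -> R) : Prop :=
  forall u X Y, slit u -> pi_smooth u X -> pi_smooth u Y -> A X Y u = B X Y u.

End Finsler.

(* [D] and [D'] stand for the connections without and with tilde. *)
Section Comparison.
Context {R : realType} {n : nat} {M : smooth_manifold R n}.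
Variables D D' : linear_connection M.
Implicit Types X Y Z : pifield M.

Definition omega (X : vfield M) Y : pifield M := fun u =>
  nabla D' X Y u - nabla D X Y u.

Definition Bdiff X Y : pifield M := omega (beta D X) Y.
Definition Ndiff X : pifield M := Bdiff X eta.
Definition Ldiff (X : vfield M) : vfield M := gamma (Ndiff (rho X)).

Definition nablaB (W : vfield M) Y Z : pifield M := fun u =>
  nabla D W (Bdiff Y Z) u - Bdiff (nabla D W Y) Z u - Bdiff Y (nabla D W Z) u.

Definition alternate (Th : pifield M -> pifield M -> pifield M) X Y :
  pifield M := fun u => Th X Y u - Th Y X u.

Definition Hdiff X Y Z : pifield M := fun u =>
  Scurv D (Ndiff X) (Ndiff Y) Z u
  - alternate (fun X Y => fun u =>
        Pcurv D X (Ndiff Y) Z u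
        + nablaB (beta D X) Y Z u
        - nablaB (Ldiff (beta D X)) Y Z u
        + Bdiff X (Bdiff Y Z) u
        - Bdiff (Ttor D (Ndiff X) Y) Z u) X Y u.

Definition traceless_H : Prop := forall u X Y, slit u ->
  pi_smooth u X -> pi_smooth u Y -> Tr (fun Z => Hdiff X Z Y) u = 0.

End Comparison.

(* Main.v *)
From HB Require Import structures.
Require Import Defs.
From mathcomp Require Import all_boot all_order all_algebra.
From mathcomp Require Import all_classical all_reals all_analysis.
From mathcomp Require Import lra ring.
Set Implicit Arguments.
Unset Strict Implicit.
Unset Printing Implicit Defensive.
Import Order.TTheory GRing.Theory Num.Theory.
Import numFieldNormedType.Exports.
Local Open Scope classical_set_scope.
Local Open Scope ring_scope.

(** Both Cartan connections differentiate in the same way along vertical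
    vectors.  Indeed, write [cov D u (0, a) Y] as the derivative of the
    components of [Y] along the fibre plus an endomorphism [C_a].  The torsion
    [T] evaluated on [a] is [C_a], so the third axiom of a Cartan connection
    says that [C_a] is [g]-symmetric, and metricity then makes it half the
    derivative of [g] along the fibre, which ignores a factor
    [expR (2 * sigma)] that is constant on fibres ([vertical_cov_eq]).  Since
    the metric is a fibre Hessian of the 2-homogeneous function [L ^+ 2 / 2],
    Euler's relation and the symmetry of third derivatives give [C_a eta = 0],
    i.e. [cov D u (0, a) eta = a] ([cov_vertical_eta]), and also
    [g (eta, eta) = L ^+ 2] ([g_eta]).

    It follows that the difference of the two connections depends only on the
    horizontal part of the direction, so that it is the tensor [B]
    ([cov_compare]), and that the horizontal lifts are related by
    [beta' X = beta X - gamma (N X)] ([beta_compare]).  Expanding the curvature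
    of [D'] on the lifts [beta' X] and [beta' Y], first with respect to the
    connection ([curvature_compare]) and then with respect to the lifts, yields
    exactly [R' = R + H] ([curvature_change]); the torsion of [D] on the new
    lifts enters through [Q = 0] and [T].

    Taking traces, [Tr H = 0] gives [Ric' = Ric].  The operators [Ric0] are
    obtained from the Ricci tensors by raising an index, so that
    [Sc' = expR (- 2 * sigma) * Sc]; this cancels against the factor of the
    metric in [Sc * g] and in [Sc * L ^+ 2 = Sc * g (eta, eta)], which accounts
    for the remaining invariants.

    These manipulations rest on a calculus of smooth functions.  Smoothness is
    defined by means of iterated directional derivatives; continuity of these
    derivatives makes every iterate Frechet differentiable
    ([continuous_directional_differentiable_vector]), whence the chain rule,
    stability under composition and Schwarz's theorem.  The components of a
    field in two charts being related by the differential of the transition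
    map, a field smooth around a vector is smooth around every nearby vector
    ([pi_smooth_near]).  Horizontal lifts are smooth since they are obtained by
    solving a linear system with smooth coefficients ([v_smooth_beta]). *)

(** * Differentiability from continuous directional derivatives *)

(** A basis with continuous dual basis.  Keeping the space abstract lets one
    calculus serve the coordinate domains of [M], those of [TM], and the
    scalars. *)
Class coordinates (R : realType) (V : normedModType R) := Coordinates {
  cdim : nat;
  cvec : 'I_cdim -> V;
  ccoef : 'I_cdim -> {linear V -> R^o};
  ccoef_continuous : forall i, continuous (ccoef i);
  coordsE : forall v, v = \sum_i ccoef i v *: cvec i }.

Section Directional.
Context {R : realType} {V : normedModType R}.
Implicit Types (f : V -> R).

Lemma derivable_line (W : normedModType R) (f : V -> W) (p b : V) (t : R) :
  derivable f (t *: b + p) b ->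
  is_derive t 1 (fun s : R => f (s *: b + p)) ('D_b f (t *: b + p)).
Proof.
have E : (fun h : R => h^-1 *: (((fun s : R => f (s *: b + p)) \o shift t) (h *: 1)
    - f (t *: b + p))) =
  (fun h : R => h^-1 *: ((f \o shift (t *: b + p)) (h *: b) - f (t *: b + p))).
  by apply/funext => h /=; rewrite [h *: 1]mulr1 scalerDl addrA.
by move=> df; split; rewrite /derivable /derive E.
Qed.

(** The mean value theorem along a segment of either orientation: the signs of
    the increments [c] are not known where it is applied. *)
Lemma mean_value f (p b : V) (c : R) :
  (forall t : R, `|t| <= `|c| -> derivable f (t *: b + p) b) ->
  exists2 t : R, `|t| <= `|c| & f (c *: b + p) - f p = c * 'D_b f (t *: b + p).
Proof.
move=> df.
pose F s := f (s *: b + p).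
have F0 : F 0 = f p by rewrite /F scale0r add0r.
have dF (t : R) : `|t| <= `|c| -> is_derive t 1 F ('D_b f (t *: b + p)).
  by move=> /df; apply: derivable_line.
have cF (t : R) : `|t| <= `|c| -> {for t, continuous F}.
  move=> /dF [dt _]; apply: differentiable_continuous.
  exact/derivable1_diffP.
have [c0|c0] := leP 0 c.
  have [||t] := @MVT_segment _ F (fun t => 'D_b f (t *: b + p)) 0 c c0.
  - move=> x; rewrite in_itv/= => /andP[x0 xc].
    by apply: dF; rewrite !ger0_norm // ltW.
  - apply: continuous_in_subspaceT => x; rewrite inE/= in_itv/= => /andP[x0 xc].
    by apply: cF; rewrite !ger0_norm.
  rewrite in_itv/= => /andP[t0 tc]; rewrite F0 subr0 mulrC => E.
  by exists t => //; rewrite !ger0_norm.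
have [||t] := @MVT_segment _ F (fun t => 'D_b f (t *: b + p)) c 0 (ltW c0).
- move=> x; rewrite in_itv/= => /andP[x0 xc].
  by apply: dF; rewrite !ltr0_norm // lerN2 ltW.
- apply: continuous_in_subspaceT => x; rewrite inE/= in_itv/= => /andP[x0 xc].
  by apply: cF; rewrite !ler0_norm ?lerN2 // ltW.
rewrite in_itv/= => /andP[t0 tc]; rewrite F0 => E.
exists t; first by rewrite !ler0_norm ?lerN2 // ltW.
by rewrite -/(F c) -[LHS]opprB E sub0r mulrN opprK mulrC.
Qed.

Context {cV : coordinates V}.

Lemma ccoef_le i : exists2 C : R, 0 < C & forall v, `|ccoef i v : R| <= C * `|v|.
Proof.
have [_/posnumP[k] hk] := linear_lipschitz (ccoef_continuous (i := i)).
by exists k%:num.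
Qed.

(** The increment of [f] is a telescoping sum of increments along the basis
    vectors; the mean value theorem turns each of them into a value of a
    partial derivative near [a], which is close to the value at [a].  The claim
    proved by induction is the estimate for a partial sum of coordinates. *)
Lemma continuous_directional_differentiable f (a : V) :
  (forall v, \forall x \near a, derivable f x v) ->
  (forall v, {for a, continuous ('D_v f)}) -> differentiable f a.
Proof.
move=> df cDf.
pose S (s : seq 'I_(@cdim _ _ cV)) (h : V) : V := \sum_(i <- s) ccoef i h *: cvec i.
pose d (s : seq 'I_(@cdim _ _ cV)) (h : V) : R := \sum_(i <- s) ccoef i h * 'D_(cvec i) f a.
have claim s (e : R) : 0 < e ->
    \forall h \near (0 : V), `|f (S s h + a) - f a - d s h| <= e * `|h|.
  elim: s e => [|i s IH] e e0.
    near=> h; rewrite /S /d !big_nil add0r !subrr normr0.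
    by rewrite mulr_ge0 // ltW.
  have [C C0 hC] := ccoef_le i.
  have eC : 0 < e / 2 / C by rewrite !divr_gt0.
  have : \forall x \near a, derivable f x (cvec i) /\
      `|'D_(cvec i) f a - 'D_(cvec i) f x| < e / 2 / C.
    near=> x; split; first by near: x; exact: df.
    by near: x; have /cvgrPdist_lt := cDf (cvec i); apply.
  move=> /nbhs_ballP[r /= r0 hr].
  have [K K0 hK] : exists2 K : R, 0 < K & forall h, `|S s h| <= K * `|h|.
    rewrite /S; elim: (s) => [|j t [K K0 hK]].
      by exists 1 => // h; rewrite big_nil normr0 mul1r.
    have [D D0 hD] := ccoef_le j.
    exists (D * `|cvec j| + K) => [|h].
      by rewrite ltr_wpDl // mulr_ge0 // ltW.
    rewrite big_cons mulrDl (le_trans (ler_normD _ _)) // lerD //.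
    by rewrite normrZ mulrAC ler_wpM2r.
  (* For [h] of norm less than [m] the whole segment stays in the ball. *)
  pose m := r / (C * `|cvec i| + K).
  have m0 : 0 < m by rewrite divr_gt0 // ltr_wpDl // mulr_ge0 // ltW.
  near=> h.
  have hm : `|h| < m.
    near: h; apply/nbhs_ballP; exists m => //= x.
    by rewrite -ball_normE /= sub0r normrN.
  have hb t : `|t| <= `|ccoef i h : R| ->
      ball a r (t *: cvec i + (S s h + a)).
    move=> tc; rewrite -ball_normE /= addrA opprD addrCA subrr addr0 normrN.
    apply: le_lt_trans (ler_normD _ _) _; rewrite normrZ.
    apply: (@le_lt_trans _ _ ((C * `|cvec i| + K) * `|h|)).
      rewrite mulrDl lerD // mulrAC ler_wpM2r //.
      exact: le_trans tc _.
    by rewrite mulrC -ltr_pdivlMr // ltr_wpDl // mulr_ge0 // ltW.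
  have [|t tc E] := @mean_value f (S s h + a) (cvec i) (ccoef i h).
    by move=> t /hb/hr [].
  have [_ hD] := hr _ (hb _ tc).
  have IHh : `|f (S s h + a) - f a - d s h| <= e / 2 * `|h|.
    by near: h; apply: IH; rewrite divr_gt0.
  have -> : f (S (i :: s) h + a) - f a - d (i :: s) h =
      (f (S s h + a) - f a - d s h) + (ccoef i h : R) *
        ('D_(cvec i) f (t *: cvec i + (S s h + a)) - 'D_(cvec i) f a).
    have -> : S (i :: s) h + a = (ccoef i h : R) *: cvec i + (S s h + a).
      by rewrite /S big_cons addrA.
    have -> : d (i :: s) h = (ccoef i h : R) * 'D_(cvec i) f a + d s h.
      by rewrite /d big_cons.
    rewrite mulrBr -E; ring.
  rewrite (le_trans (ler_normD _ _)) // [e]splitr mulrDl lerD // normrM.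
  rewrite distrC (le_trans (ler_pM _ _ (hC h) (ltW hD))) //.
  by rewrite mulrAC mulrCA divff ?mulr1 // gt_eqF.
have dlin : linear (d (index_enum 'I_(@cdim _ _ cV)) : V -> R^o).
  move=> k u v; rewrite /d scaler_sumr -big_split /=; apply: eq_bigr => i _.
  by rewrite linearP /= mulrDl -scalerAl.
pose dL := GRing.isLinear.Build _ _ _ _ _ dlin.
pose dl : {linear V -> R^o} := HB.pack (d (index_enum 'I_(@cdim _ _ cV))) dL.
have dc : continuous dl.
  apply: (@continuous_big R^o _ +%R) => [|i _ x]; first exact: add_continuous.
  by apply: cvgM; [exact: ccoef_continuous|exact: cvg_cst].
have E : f \o shift a = cst (f a) + dl +o_ (0 : V) id.
  apply/eqaddoP => e e0; near=> h.
  have -> : (f \o shift a - (cst (f a) + dl)) h =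
     f (S (index_enum 'I_(@cdim _ _ cV)) h + a) - f a - d (index_enum 'I_(@cdim _ _ cV)) h.
    by rewrite /S -coordsE /= opprD addrA.
  by near: h; exact: claim.
apply/diff_locallyP; split.
  by rewrite (diff_unique dc E).
by rewrite (diff_unique dc E).
Unshelve. all: by end_near. Qed.

End Directional.

Section Instances.
Context {R : realType}.

Lemma fct_linear (V W : lmodType R) (f : V -> W) : linear f ->
  exists g : {linear V -> W}, g = f :> (V -> W).
Proof.
move=> fl; pose m := GRing.isLinear.Build _ _ _ _ _ fl.
by exists (HB.pack f m : {linear V -> W}).
Qed.

(** Instances are built from plain functions, the linear structure of the
    coordinates being packed here once. *)
Lemma coordinates_of (V : normedModType R) (d : nat) (b : 'I_d -> V)
    (c : 'I_d -> V -> R^o) :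
  (forall i, linear (c i)) -> (forall i, continuous (c i)) ->
  (forall v, v = \sum_i c i v *: b i) -> coordinates V.
Proof.
move=> cl cc cE.
pose m i := GRing.isLinear.Build _ _ _ _ _ (cl i).
pose l i : {linear V -> R^o} := HB.pack (c i) (m i).
exact: (@Coordinates R V d b l).
Defined.

#[global] Instance coordinates_real : coordinates R.
Proof.
apply: (@coordinates_of R 1 (fun=> 1) (fun=> id)) => //.
- by move=> _ x; apply: cvg_id.
- by move=> v; rewrite big_ord1 [RHS]mulr1.
Defined.

#[global] Instance coordinates_row n : coordinates 'rV[R]_n.
Proof.
apply: (@coordinates_of _ n (fun i => delta_mx 0 i) (fun i v => v 0 i)).
- by move=> i a u v; rewrite !mxE.
- by move=> i; exact: coord_continuous.
- exact: row_sum_delta.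
Defined.

#[global] Instance coordinates_pair (V W : normedModType R)
  (cV : coordinates V) (cW : coordinates W) : coordinates (V * W)%type.
Proof.
refine (@coordinates_of (V * W)%type (@cdim _ _ cV + @cdim _ _ cW)
  (fun i => match fintype.split i with
            | inl j => (cvec j, 0) | inr j => (0, cvec j) end)
  (fun i (v : V * W) => match fintype.split i return R^o with
              | inl j => ccoef j v.1 | inr j => ccoef j v.2 end) _ _ _).
- by move=> i a u v; case: fintype.split => j; rewrite linearP.
- move=> i; case: fintype.split => j x.
    by apply: continuous_comp; [exact: cvg_fst|exact: ccoef_continuous].
  by apply: continuous_comp; [exact: cvg_snd|exact: ccoef_continuous].
- move=> [v w]; rewrite big_split_ord /=.
  under eq_bigr => i _ do rewrite (unsplitK (inl _ i)).
  under [X in _ = _ + X]eq_bigr => i _ do rewrite (unsplitK (inr _ i)).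
  rewrite {1}[v]coordsE {1}[w]coordsE.
  have -> : \sum_i ccoef i v *: ((cvec i, 0) : V * W) =
      (\sum_i ccoef i v *: cvec i, 0).
    elim/big_ind2 : _ => // [x x' y y' -> ->|i _]; rewrite /GRing.add /= /GRing.scale /=.
      by congr pair; rewrite addr0.
    by congr pair; rewrite scaler0.
  have -> : \sum_i ccoef i w *: ((0, cvec i) : V * W) =
      (0, \sum_i ccoef i w *: cvec i).
    elim/big_ind2 : _ => // [x x' y y' -> ->|i _].
      by congr pair; rewrite addr0.
    by congr pair; rewrite scaler0.
  by congr pair; rewrite ?addr0 ?add0r.
Defined.

End Instances.

(** * Rules for directional derivatives *)

Section Rules.
Context {R : realType}.
Implicit Types U V W : normedModType R.

Lemma is_derive_linear V W W' (l : {linear W -> W'}) (f : V -> W) a v :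
  continuous l -> derivable f a v ->
  is_derive a v (l \o f) (l ('D_v f a)).
Proof.
move=> lc df.
have : (fun h : R => h^-1 *: (((l \o f) \o shift a) (h *: v) - (l \o f) a)) @ 0^'
    --> l ('D_v f a).
  have -> : (fun h : R => h^-1 *: (((l \o f) \o shift a) (h *: v) - (l \o f) a))
     = l \o (fun h : R => h^-1 *: ((f \o shift a) (h *: v) - f a)).
    by apply/funext => h /=; rewrite [RHS]linearZ /= [in RHS](linearB l).
  exact: (cvg_comp _ _ df (lc _)).
by move=> cv; split; [apply/cvg_ex; exists (l ('D_v f a))|exact: cvg_lim].
Qed.

(** The mean value theorem holds for scalar functions only, hence the passage to
    the coordinates of the target. *)
Lemma continuous_directional_differentiable_vector V W (cV : coordinates V)
    (cW : coordinates W) (f : V -> W) (a : V) :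
  (forall v, \forall x \near a, derivable f x v) ->
  (forall v, {for a, continuous ('D_v f)}) -> differentiable f a.
Proof.
move=> df cDf.
have -> : f = \sum_(j < @cdim _ _ cW) (fun x => (ccoef j (f x) : R) *: cvec j).
  by apply/funext => x; rewrite fct_sumE -coordsE.
apply: differentiable_sum => j; apply: differentiableZl.
apply: continuous_directional_differentiable => v.
  near=> x; have dx : derivable f x v by near: x; exact: df.
  by have [] := is_derive_linear (@ccoef_continuous _ _ cW j) dx.
have E : \forall x \near a, ccoef j ('D_v f x) = 'D_v (fun x => ccoef j (f x) : R) x.
  near=> x; have dx : derivable f x v by near: x; exact: df.
  by have [_ <-] := is_derive_linear (@ccoef_continuous _ _ cW j) dx.
apply: cvg_trans (near_eq_cvg E) _; rewrite -(nbhs_singleton E).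
by apply: (cvg_comp _ _ (cDf v)); exact: ccoef_continuous.
Unshelve. all: by end_near. Qed.

Lemma scale_is_bilinear W : bilinear_for
    (GRing.Scale.Law.clone _ _ *:%R _) (GRing.Scale.Law.clone _ _ *:%R _)
    (@GRing.scale R W : R^o -> W -> W).
Proof.
split=> [u'|u] a x y /=; first by rewrite scalerDl scalerA.
by rewrite scalerDr !scalerA mulrC.
Qed.

Lemma diff_scale V W (k : V -> R) (f : V -> W) a :
  differentiable k a -> differentiable f a ->
  differentiable (fun x => k x *: f x) a /\
  forall v, 'D_v (fun x => k x *: f x) a = k a *: 'D_v f a + 'D_v k a *: f a.
Proof.
move=> dk df.
pose m := bilinear_isBilinear.Build R R^o W W _ _ (@GRing.scale R W) (@scale_is_bilinear W).
pose b : {bilinear R^o -> W -> W} := HB.pack (@GRing.scale R W : R^o -> W -> W) m.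
have bc : continuous (fun p : R^o * W => b p.1 p.2).
  by move=> p; apply: cvgZ; [exact: cvg_fst|exact: cvg_snd].
have E : (fun x => k x *: f x) = (fun p : R^o * W => b p.1 p.2) \o (fun x => (k x, f x)).
  by [].
have dp : differentiable (fun x => (k x, f x)) a by exact: differentiable_pair.
have db := differentiable_bilin (k a, f a) bc.
have d : differentiable (fun x => k x *: f x) a.
  by rewrite E; apply: differentiable_comp.
split=> // v; rewrite !deriveE // E diff_comp //.
have -> : forall (g : R^o * W -> W) q, ('d g (k a, f a) \o 'd (fun x => (k x, f x)) a) q =
   'd g (k a, f a) ('d k a q, 'd f a q) by move=> g q; rewrite /= diff_pair.
by rewrite diff_bilin.
Qed.

Lemma derive_comp U V W (g : U -> V) (f : V -> W) a v :
  differentiable g a -> differentiable f (g a) ->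
  'D_v (f \o g) a = 'D_('D_v g a) f (g a).
Proof.
move=> dg df; have dfg := differentiable_comp dg df.
by rewrite (deriveE v dfg) (deriveE v dg) (deriveE _ df) diff_comp.
Qed.

Lemma derive_linear_dir V W (f : V -> W) a k v w : differentiable f a ->
  'D_(k *: v + w) f a = k *: 'D_v f a + 'D_w f a.
Proof. by move=> df; rewrite !deriveE // linearP. Qed.

Lemma derive_coords V W (cV : coordinates V) (f : V -> W) a v :
  differentiable f a ->
  'D_v f a = \sum_i ccoef i v *: 'D_(cvec i) f a.
Proof.
move=> df; rewrite deriveE // {1}[v]coordsE linear_sum.
by apply: eq_bigr => i _; rewrite linearZ /= deriveE.
Qed.

End Rules.

(** * Functions of class C^k on an open set *)

Section Ck.
Context {R : realType}.
Implicit Types U V W : normedModType R.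

(** Differentiability depends only on the germ: the expansion of [f] to first
    order is one of [g], and it determines the differential. *)
Lemma near_eq_differentiable V W (f g : V -> W) a :
  {near a, f =1 g} -> differentiable f a -> differentiable g a.
Proof.
move=> fg df.
have E : g \o shift a = cst (g a) + 'd f a +o_ (0 : V) id.
  apply/eqaddoP => e e0; rewrite -(nbhs_singleton fg).
  have /eqaddoP/(_ e e0) H := diff_locally df.
  have fg0 : \forall h \near (0 : V), f (h + a) = g (h + a).
    by move: fg; rewrite (near_shift 0) /= subr0.
  near=> h; have -> : (g \o shift a - (cst (f a) + 'd f a)) h =
     (f \o shift a - (cst (f a) + 'd f a)) h.
    rewrite /= -[RHS]/(f (h + a) - _) -[LHS]/(g (h + a) - _); congr (_ - _).
    by near: h; apply: filterS fg0 => h ->.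
  by near: h.
have c : continuous ('d f a) by exact: diff_continuous.
by apply/diff_locallyP; rewrite (diff_unique c E).
Unshelve. all: by end_near. Qed.

(** Fixing the open set and the order makes stability under products and
    composition provable by induction on [k]; each derivative is expressed by
    functions of one order less on the same set. *)
Fixpoint Ck V W k (A : set V) (f : V -> W) : Prop :=
  if k is j.+1 then
    (forall a, A a -> differentiable f a) /\ forall v, Ck j A ('D_v f)
  else forall a, A a -> {for a, continuous f}.

Lemma Ck_eq V W k (A : set V) (f g : V -> W) :
  open A -> (forall a, A a -> f a = g a) -> Ck k A f -> Ck k A g.
Proof.
move=> oA; elim: k f g => [|k IH] f g fg.
  move=> cf a Aa; have nA := open_nbhs_nbhs (conj oA Aa).
  have E : {near a, f =1 g} by apply: filterS nA => x /fg.
  have cfa : f x @[x --> a] --> f a := cf _ Aa.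
  by rewrite fg // in cfa; exact: (cvg_trans (near_eq_cvg E) cfa).
move=> [df cf]; split=> [a Aa|v].
  apply: near_eq_differentiable (df _ Aa).
  by apply: filterS (open_nbhs_nbhs (conj oA Aa)) => x /fg.
apply: IH (cf v) => a Aa; apply: near_eq_derive.
by apply: filterS (open_nbhs_nbhs (conj oA Aa)) => x /fg.
Qed.

Lemma CkS V W k (A : set V) (f : V -> W) : Ck k.+1 A f -> Ck k A f.
Proof.
elim: k f => [|k IH] f [df cf].
  by move=> a /df; exact: differentiable_continuous.
by split=> // v; exact: IH.
Qed.

Lemma Ck_sub V W k (A B : set V) (f : V -> W) :
  B `<=` A -> Ck k A f -> Ck k B f.
Proof.
move=> BA; elim: k f => [|k IH] f.
  by move=> cf a /BA; exact: cf.
by move=> [df cf]; split=> [a /BA|v]; [exact: df|exact: IH (cf v)].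
Qed.

Lemma Ck_cst V W k (A : set V) (c : W) : Ck k A (cst c : V -> W).
Proof.
elim: k c => [|k IH] c; first by move=> a _; exact: cvg_cst.
split=> [a _|v]; first exact: differentiable_cst.
have -> : 'D_v (cst c : V -> W) = cst 0.
  by apply/funext => x; rewrite derive_cst.
exact: IH.
Qed.

Lemma Ck_linear V W W' k (A : set V) (l : {linear W -> W'}) (f : V -> W) :
  open A -> continuous l -> Ck k A f -> Ck k A (l \o f).
Proof.
move=> oA lc; elim: k f => [|k IH] f.
  by move=> cf a Aa; apply: continuous_comp; [exact: cf|exact: lc].
move=> [df cf]; split=> [a Aa|v].
  by apply: differentiable_comp; [exact: df|exact: linear_differentiable].
apply: Ck_eq (IH _ (cf v)) => // a Aa.
by have [_ ->] := is_derive_linear (v := v) lc (diff_derivable (df _ Aa)).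
Qed.

Lemma Ck_add V W k (A : set V) (f g : V -> W) :
  open A -> Ck k A f -> Ck k A g -> Ck k A (fun x => f x + g x).
Proof.
move=> oA; elim: k f g => [|k IH] f g.
  by move=> cf cg a Aa; apply: continuousD; [exact: cf|exact: cg].
move=> [df cf] [dg cg]; split=> [a Aa|v].
  by apply: differentiableD; [exact: df|exact: dg].
apply: Ck_eq (IH _ _ (cf v) (cg v)) => // a Aa.
by rewrite (@deriveD _ _ _ f g) //; apply: diff_derivable; [exact: df|exact: dg].
Qed.

Lemma Ck_scale V W k (A : set V) (c : V -> R) (f : V -> W) :
  open A -> Ck k A c -> Ck k A f -> Ck k A (fun x => c x *: f x).
Proof.
move=> oA; elim: k c f => [|k IH] c f.
  by move=> cc cf a Aa; apply: cvgZ; [exact: cc|exact: cf].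
move=> c1 f1; have [dc cc] := c1; have [df cf] := f1; split=> [a Aa|v].
  by have [] := diff_scale (dc _ Aa) (df _ Aa).
have h := Ck_add oA (IH _ _ (CkS c1) (cf v)) (IH _ _ (cc v) (CkS f1)).
apply: Ck_eq h => // a Aa.
by have [_ ->] := diff_scale (dc _ Aa) (df _ Aa).
Qed.

Lemma Ck_sum V W (I : Type) (s : seq I) (F : I -> V -> W) k (A : set V) :
  open A -> (forall i, Ck k A (F i)) -> Ck k A (fun x => \sum_(i <- s) F i x).
Proof.
move=> oA cF; elim: s => [|i s IH].
  apply: Ck_eq (Ck_cst k A 0) => // a _; by rewrite big_nil.
by apply: Ck_eq (Ck_add oA (cF i) IH) => // a _; rewrite big_cons.
Qed.

Lemma derive_pair V W W' (f : V -> W) (g : V -> W') a v :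
  differentiable f a -> differentiable g a ->
  'D_v (fun x => (f x, g x)) a = ('D_v f a, 'D_v g a).
Proof.
move=> df dg; rewrite !deriveE ?diff_pair //.
exact: differentiable_pair.
Qed.

Lemma Ck_pair V W W' k (A : set V) (f : V -> W) (g : V -> W') :
  open A -> Ck k A f -> Ck k A g -> Ck k A (fun x => (f x, g x)).
Proof.
move=> oA; elim: k f g => [|k IH] f g.
  by move=> cf cg a Aa; apply: cvg_pair; [exact: cf|exact: cg].
move=> [df cf] [dg cg]; split=> [a Aa|v].
  by apply: differentiable_pair; [exact: df|exact: dg].
apply: Ck_eq (IH _ _ (cf v) (cg v)) => // a Aa.
by rewrite derive_pair //; [exact: df|exact: dg].
Qed.

(** In coordinates the chain rule is a sum of products of derivatives of [g]
    with [(D_i f) \o g], to which the induction hypothesis applies. *)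
Lemma Ck_comp U V W (cV : coordinates V) k (A : set U) (B : set V)
    (g : U -> V) (f : V -> W) :
  open A -> (forall a, A a -> B (g a)) -> Ck k A g -> Ck k B f ->
  Ck k A (f \o g).
Proof.
move=> oA gAB; elim: k f => [|k IH] f.
  by move=> cg cf a Aa; apply: continuous_comp; [exact: cg|exact/cf/gAB].
move=> g1 [df cf]; have [dg cg] := g1; split=> [a Aa|v].
  by apply: differentiable_comp; [exact: dg|exact/df/gAB].
have h : Ck k A (fun x => \sum_i (ccoef i ('D_v g x) : R) *: 'D_(cvec i) f (g x)).
  apply: Ck_sum => // i; apply: Ck_scale => //.
    exact: (Ck_linear oA (@ccoef_continuous _ _ cV i) (cg v)).
  exact: IH (CkS g1) (cf _).
apply: Ck_eq h => // a Aa; rewrite derive_comp; [|exact: dg|exact/df/gAB].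
by rewrite derive_coords //; exact/df/gAB.
Qed.

Lemma Ck_inv V k (A : set V) (f : V -> R) :
  open A -> (forall a, A a -> f a != 0) -> Ck k A f -> Ck k A (fun x => (f x)^-1).
Proof.
move=> oA f0; elim: k => [|k IH].
  by move=> cf a Aa; apply: cvgV; [exact: f0|exact: cf].
move=> f1; have [df cf] := f1; split=> [a Aa|v].
  by apply: differentiableV; [exact: df|exact: f0].
have i := IH (CkS f1).
have h := Ck_scale oA (Ck_scale oA (Ck_cst k A (-1 : R)) (Ck_scale oA i i)) (cf v).
apply: Ck_eq h => // a Aa.
rewrite (@deriveV _ _ f) ?f0 //; last exact/diff_derivable/df.
by rewrite /GRing.scale /= mulN1r -expr2 exprVn.
Qed.

Lemma iterD_rcons V W (vs : seq V) v (f : V -> W) :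
  Defs.iterD (rcons vs v) f = Defs.iterD vs ('D_v f).
Proof. by elim: vs => //= w vs ->. Qed.

(** One open set must serve all orders: the definition of smoothness quantifies
    over the iterated derivatives inside the neighbourhood. *)
Lemma smooth_atP V W (cV : coordinates V) (cW : coordinates W) (f : V -> W) z :
  smooth_at f z <-> exists A : set V, [/\ open A, A z & forall k, Ck k A f].
Proof.
split=> [sf|[A [oA Az cf]]].
  exists (interior [set a | forall vs : seq V,
    {for a, continuous (Defs.iterD vs f)} /\ forall v, derivable (Defs.iterD vs f) a v]).
  set A := interior _.
  have oA : open A by exact: open_interior.
  have hA a : A a -> forall vs : seq V, {for a, continuous (Defs.iterD vs f)} /\
      forall v, derivable (Defs.iterD vs f) a v by move=> /interior_subset.
  split=> // k; move: A oA hA => A oA hA.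
  elim: k (f) hA => [|k IH] h hA /=.
    by move=> a /hA/(_ [::])[].
  split=> [a Aa|v].
    have nA := open_nbhs_nbhs (conj oA Aa).
    apply: continuous_directional_differentiable_vector => v.
      by apply: filterS nA => x /hA/(_ [::])[_].
    by have [] := hA _ Aa [:: v].
  apply: IH => a Aa vs; have := hA _ Aa (rcons vs v).
  by rewrite iterD_rcons.
have cD vs : forall k, Ck k A (Defs.iterD vs f).
  by elim: vs => [|v vs IH] k; [exact: cf|exact: (proj2 (IH k.+1) v)].
apply: filterS (open_nbhs_nbhs (conj oA Az)) => a Aa vs.
split; first exact: (cD vs 0).
by move=> v; apply: diff_derivable; have [d _] := cD vs 1%N; exact: d.
Qed.

End Ck.

(** * Smooth germs *)

Section Smooth.
Context {R : realType} {U V W W' : normedModType R}.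
Context {cU : coordinates U} {cV : coordinates V} {cW : coordinates W}.
Context {cW' : coordinates W'}.

Lemma smooth_near_eq (f g : V -> W) z :
  smooth_at f z -> {near z, f =1 g} -> smooth_at g z.
Proof.
move=> /smooth_atP[A [oA Az cf]] fg; apply/smooth_atP.
exists (A `&` interior [set x | f x = g x]); split.
- by apply: openI => //; exact: open_interior.
- by split.
- move=> k; apply: (@Ck_eq _ _ _ k _ f).
  + by apply: openI => //; exact: open_interior.
  + by move=> a [_ /interior_subset].
  + by apply: Ck_sub (cf k) => x [].
Qed.

Lemma smooth_ext (f g : V -> W) z : smooth_at f z -> f =1 g -> smooth_at g z.
Proof. by move=> sf /funext <-. Qed.

Lemma smooth_near (f : V -> W) z :
  smooth_at f z -> \forall a \near z, smooth_at f a.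
Proof. exact: near_join. Qed.

Lemma smooth_differentiable (f : V -> W) z :
  smooth_at f z -> differentiable f z.
Proof. by move=> /smooth_atP[A [oA Az cf]]; exact: (proj1 (cf 1%N)). Qed.

Lemma smooth_continuous (f : V -> W) z : smooth_at f z -> {for z, continuous f}.
Proof. by move/smooth_differentiable/differentiable_continuous. Qed.

Lemma smooth_derive (f : V -> W) z v : smooth_at f z -> smooth_at ('D_v f) z.
Proof.
move=> /smooth_atP[A [oA Az cf]]; apply/smooth_atP.
by exists A; split=> // k; exact: (proj2 (cf k.+1) v).
Qed.

Lemma smooth_cst (c : W) (z : V) : smooth_at (fun=> c) z.
Proof.
by apply/smooth_atP; exists setT; split=> // [|k]; [exact: openT|exact: Ck_cst].
Qed.

Lemma smooth_linear (l : {linear W -> W'}) (f : V -> W) z :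
  continuous l -> smooth_at f z -> smooth_at (fun x => l (f x)) z.
Proof.
move=> lc /smooth_atP[A [oA Az cf]]; apply/smooth_atP.
by exists A; split=> // k; exact: (Ck_linear oA lc (cf k)).
Qed.

Lemma smooth_add (f g : V -> W) z :
  smooth_at f z -> smooth_at g z -> smooth_at (fun x => f x + g x) z.
Proof.
move=> /smooth_atP[A [oA Az cf]] /smooth_atP[B [oB Bz cg]]; apply/smooth_atP.
exists (A `&` B); split=> // [|k]; first exact: openI.
apply: Ck_add; first exact: openI.
  by apply: Ck_sub (cf k) => x [].
by apply: Ck_sub (cg k) => x [].
Qed.

Lemma smooth_scale (c : V -> R) (f : V -> W) z :
  smooth_at c z -> smooth_at f z -> smooth_at (fun x => c x *: f x) z.
Proof.
move=> /smooth_atP[A [oA Az cf]] /smooth_atP[B [oB Bz cg]]; apply/smooth_atP.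
exists (A `&` B); split=> // [|k]; first exact: openI.
apply: Ck_scale; first exact: openI.
  by apply: Ck_sub (cf k) => x [].
by apply: Ck_sub (cg k) => x [].
Qed.

Lemma smooth_pair (f : V -> W) (g : V -> W') z :
  smooth_at f z -> smooth_at g z -> smooth_at (fun x => (f x, g x)) z.
Proof.
move=> /smooth_atP[A [oA Az cf]] /smooth_atP[B [oB Bz cg]]; apply/smooth_atP.
exists (A `&` B); split=> // [|k]; first exact: openI.
apply: Ck_pair; first exact: openI.
  by apply: Ck_sub (cf k) => x [].
by apply: Ck_sub (cg k) => x [].
Qed.

End Smooth.

Section SmoothComp.
Context {R : realType} {U V W : normedModType R}.
Context {cU : coordinates U} {cV : coordinates V} {cW : coordinates W}.

Lemma smooth_inv (f : V -> R) z :
  f z != 0 -> smooth_at f z -> smooth_at (fun x => (f x)^-1) z.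
Proof.
move=> fz sf; have nz : \forall x \near z, f x != 0.
  have c : f x @[x --> z] --> f z by exact: smooth_continuous sf.
  exact: (cvgr_neq0 _ c fz).
move: sf => /smooth_atP[A [oA Az cf]]; apply/smooth_atP.
exists (A `&` interior [set x | f x != 0]).
have oB : open (A `&` interior [set x | f x != 0]).
  by apply: openI => //; exact: open_interior.
split=> // k; apply: Ck_inv => //.
  by move=> a [_ /interior_subset].
by apply: Ck_sub (cf k) => x [].
Qed.

Lemma smooth_comp (g : U -> V) (f : V -> W) z :
  smooth_at g z -> smooth_at f (g z) -> smooth_at (f \o g) z.
Proof.
move=> sg; have gc := smooth_continuous sg.
move: sg => /smooth_atP[A [oA Az cg]] /smooth_atP[B [oB Bz cf]].
apply/smooth_atP; exists (A `&` interior (g @^-1` B)).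
have oC : open (A `&` interior (g @^-1` B)).
  by apply: openI => //; exact: open_interior.
split=> //.
  by split=> //; apply: gc; exact: open_nbhs_nbhs.
move=> k; apply: (@Ck_comp _ _ _ _ _ _ _ B) => //.
- by move=> a [_ /interior_subset].
- by apply: Ck_sub (cg k) => x [].
Qed.

Lemma smooth_id (z : V) : smooth_at (fun x => x) z.
Proof.
apply/smooth_atP; exists setT; split=> // [|[|k]]; first exact: openT.
  by move=> a _; exact: cvg_id.
split=> [a _|v].
  by have [] := is_diff_id a.
apply: (@Ck_eq _ _ _ _ _ (cst v)); [exact: openT| |exact: Ck_cst].
by move=> a _; rewrite derive_id.
Qed.

End SmoothComp.

Section SmoothMore.
Context {R : realType} {U V W W' : normedModType R}.
Context {cU : coordinates U} {cV : coordinates V} {cW : coordinates W}.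
Context {cW' : coordinates W'}.

Lemma smooth_fst (f : V -> W * W') z :
  smooth_at f z -> smooth_at (fun x => (f x).1) z.
Proof.
have fl : linear (fst : W * W' -> W) by [].
have [l lE] := fct_linear fl => sf.
have lc : continuous l by rewrite lE => x; exact: cvg_fst.
have h : smooth_at (fun x => l (f x)) z by exact: smooth_linear.
by rewrite lE in h.
Qed.

Lemma smooth_snd (f : V -> W * W') z :
  smooth_at f z -> smooth_at (fun x => (f x).2) z.
Proof.
have fl : linear (snd : W * W' -> W') by [].
have [l lE] := fct_linear fl => sf.
have lc : continuous l by rewrite lE => x; exact: cvg_snd.
have h : smooth_at (fun x => l (f x)) z by exact: smooth_linear.
by rewrite lE in h.
Qed.

Lemma smooth_coef (f : V -> W) z i :
  smooth_at f z -> smooth_at (fun x => ccoef i (f x) : R) z.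
Proof.
move=> sf; exact: (smooth_linear (@ccoef_continuous _ _ cW i) sf).
Qed.

Lemma smooth_mul (f g : V -> R) z :
  smooth_at f z -> smooth_at g z -> smooth_at (fun x => f x * g x) z.
Proof. exact: smooth_scale. Qed.

Lemma smooth_sum (I : Type) (s : seq I) (P : pred I) (F : I -> V -> W) z :
  (forall i, P i -> smooth_at (F i) z) ->
  smooth_at (fun x => \sum_(i <- s | P i) F i x) z.
Proof.
move=> sF; elim: s => [|i s IH].
  apply: (smooth_near_eq (smooth_cst (0 : W) z)).
  by apply: nearW => x; rewrite big_nil.
have [Pi|nPi] := boolP (P i).
  apply: (smooth_near_eq (smooth_add (sF i Pi) IH)).
  by apply: nearW => x; rewrite big_cons Pi.
by apply: (smooth_near_eq IH); apply: nearW => x; rewrite big_cons (negbTE nPi).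
Qed.

Lemma smooth_prod (I : Type) (s : seq I) (P : pred I) (F : I -> V -> R) z :
  (forall i, P i -> smooth_at (F i) z) ->
  smooth_at (fun x => \prod_(i <- s | P i) F i x) z.
Proof.
move=> sF; elim: s => [|i s IH].
  apply: (smooth_near_eq (smooth_cst (1 : R) z)).
  by apply: nearW => x; rewrite big_nil.
have [Pi|nPi] := boolP (P i).
  apply: (smooth_near_eq (smooth_mul (sF i Pi) IH)).
  by apply: nearW => x; rewrite big_cons Pi.
by apply: (smooth_near_eq IH); apply: nearW => x; rewrite big_cons (negbTE nPi).
Qed.

End SmoothMore.

Section SmoothAlong.
Context {R : realType} {U V W : normedModType R}.
Context {cU : coordinates U} {cV : coordinates V} {cW : coordinates W}.

(** Derivatives in a varying direction at a varying point, such as occur in the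
    tangent maps of transition maps and in the components of fields. *)
Lemma smooth_derive_along (h k : U -> V) (f : V -> W) z :
  smooth_at h z -> smooth_at k z -> smooth_at f (k z) ->
  smooth_at (fun x => 'D_(h x) f (k x)) z.
Proof.
move=> sh sk sf.
have s : smooth_at (fun x => \sum_i (ccoef i (h x) : R) *: 'D_(cvec i) f (k x)) z.
  apply: smooth_sum => i _; apply: smooth_scale; first exact: smooth_coef.
  exact: (smooth_comp sk (smooth_derive _ sf)).
apply: (smooth_near_eq s).
have n : \forall x \near z, smooth_at f (k x).
  by have := smooth_continuous sk; apply; exact: smooth_near.
apply: filterS n => x /smooth_differentiable dx.
by rewrite -derive_coords.
Qed.

End SmoothAlong.

Section SmoothMatrix.
Context {R : realType} {V : normedModType R} {cV : coordinates V}.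

Lemma smooth_rowP n (f : V -> 'rV[R]_n) z :
  smooth_at f z <-> forall i, smooth_at (fun x => f x 0 i) z.
Proof.
split=> [sf i|sf].
  have fl : linear (fun v : 'rV[R]_n => v 0 i : R^o) by move=> a u v; rewrite !mxE.
  have [l lE] := fct_linear fl.
  have lc : continuous l by rewrite lE; exact: coord_continuous.
  have h : smooth_at (fun x => l (f x) : R) z by exact: (smooth_linear lc sf).
  by rewrite lE in h.
have h : smooth_at (fun x => \sum_i f x 0 i *: (delta_mx 0 i : 'rV[R]_n)) z.
  by apply: smooth_sum => i _; apply: smooth_scale => //; apply: smooth_cst.
by apply: (smooth_near_eq h); apply: nearW => x; rewrite -row_sum_delta.
Qed.

Lemma smooth_det n (A : V -> 'M[R]_n) z :
  (forall i j, smooth_at (fun x => A x i j) z) -> smooth_at (fun x => \det (A x)) z.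
Proof.
move=> sA; apply: smooth_sum => s _; apply: smooth_mul; first exact: smooth_cst.
by apply: smooth_prod => i _.
Qed.

(** Cramer's rule. *)
Lemma smooth_invmx n (A : V -> 'M[R]_n) z :
  A z \in unitmx -> (forall i j, smooth_at (fun x => A x i j) z) ->
  forall i j, smooth_at (fun x => invmx (A x) i j) z.
Proof.
move=> Az sA i j; have sd := smooth_det sA.
have dz : \det (A z) != 0 by rewrite -unitfE -unitmxE.
have nz : \forall x \near z, \det (A x) != 0.
  have c : \det (A x) @[x --> z] --> \det (A z) by exact: smooth_continuous sd.
  exact: (cvgr_neq0 _ c dz).
have s : smooth_at (fun x => (\det (A x))^-1 * (\adj (A x)) i j) z.
  apply: smooth_mul; first exact: smooth_inv.
  have h : smooth_at (fun x => cofactor (A x) j i) z.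
    apply: smooth_mul; first exact: smooth_cst.
    apply: smooth_det => k l.
    apply: (smooth_near_eq (sA (lift j k) (lift i l))).
    by apply: nearW => x; rewrite !mxE.
  by apply: (smooth_near_eq h); apply: nearW => x; rewrite mxE.
apply: (smooth_near_eq s); apply: filterS nz => x dx.
by rewrite /invmx unitmxE unitfE dx [RHS]mxE.
Qed.

End SmoothMatrix.

(** * Symmetry of second derivatives *)

Section Schwarz.
Context {R : realType} {V : normedModType R} {cV : coordinates V}.

(** Applying the mean value theorem to [x |-> f (x + t v) - f x] and then to
    [D_w f] exhibits the second difference as [t ^ 2] times a value of
    [D_v D_w f] near [z]. *)
Lemma second_difference (f : V -> R) z v w (e : R) : smooth_at f z -> 0 < e ->
  \forall t \near (0 : R),
    `|f (t *: v + (t *: w + z)) - f (t *: w + z) - (f (t *: v + z) - f z)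
      - t ^+ 2 * 'D_v ('D_w f) z| <= e * t ^+ 2.
Proof.
move=> sf e0.
have : \forall x \near z, smooth_at f x /\
   `|'D_v ('D_w f) z - 'D_v ('D_w f) x| < e.
  near=> x; split; first by near: x; exact: smooth_near.
  near: x; have /cvgrPdist_lt : 'D_v ('D_w f) x @[x --> z] --> 'D_v ('D_w f) z.
    exact: smooth_continuous (smooth_derive v (smooth_derive w sf)).
  by apply.
move=> /nbhs_ballP[r /= r0 hr].
have m0 : 0 < r / (`|v| + `|w| + 1) by rewrite divr_gt0 // ltr_wpDl // addr_ge0.
near=> t.
have tm : `|t| < r / (`|v| + `|w| + 1).
  near: t; apply/nbhs_ballP; exists (r / (`|v| + `|w| + 1)) => //= x.
  by rewrite -ball_normE /= sub0r normrN.
have inb p q : `|p| <= `|t| -> `|q| <= `|t| -> ball z r (p *: v + (q *: w + z)).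
  move=> pt qt; rewrite -ball_normE /= addrA opprD addrCA subrr addr0 normrN.
  apply: le_lt_trans (ler_normD _ _) _; rewrite !normrZ.
  apply: (@le_lt_trans _ _ (`|t| * (`|v| + `|w| + 1))).
    rewrite !mulrDr mulr1 -[leLHS]addr0; apply: lerD => //.
    by apply: lerD; apply: ler_wpM2r.
  by rewrite -ltr_pdivlMr // ltr_wpDl // addr_ge0.
have inb0 q : `|q| <= `|t| -> ball z r (q *: w + z).
  by move=> qt; have := inb 0 q; rewrite scale0r add0r normr0; apply.
(* The inner difference, whose increment along [w] is the second difference. *)
pose phi x := f (t *: v + x) - f x.
have dphi s : `|s| <= `|t| -> is_derive (s *: w + z) w phi
    ('D_w f (t *: v + (s *: w + z)) - 'D_w f (s *: w + z)).
  move=> st; have [s1 _] := hr _ (inb t s (lexx _) st).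
  have [s2 _] := hr _ (inb0 s st).
  have E : 'D_w f (t *: v + (s *: w + z)) =
      'D_w (f \o (fun x => t *: v + x)) (s *: w + z).
    rewrite /derive; have -> // : (fun h : R => h^-1 *:
        ((f \o shift (t *: v + (s *: w + z))) (h *: w) - f (t *: v + (s *: w + z)))) =
      (fun h : R => h^-1 *: (((f \o (fun x => t *: v + x)) \o shift (s *: w + z)) (h *: w)
        - (f \o (fun x => t *: v + x)) (s *: w + z))).
    by apply/funext => h /=; rewrite addrCA.
  have dc : derivable (f \o (fun x => t *: v + x)) (s *: w + z) w.
    apply: diff_derivable; apply: differentiable_comp; first exact: differentiableD.
    exact: smooth_differentiable.
  have df : derivable f (s *: w + z) w.
    by apply: diff_derivable; exact: smooth_differentiable.
  by rewrite E; have := is_deriveB (derivableP dc) (derivableP df).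
have [|s st E1] := @mean_value _ _ phi z w t; first by move=> s /dphi[].
have [_ Es] := dphi s st; rewrite Es in E1.
have [|q qt E2] := @mean_value _ _ ('D_w f) (s *: w + z) v t.
  move=> q qt; have [s1 _] := hr _ (inb q s qt st).
  exact/diff_derivable/smooth_differentiable/smooth_derive.
have [_ hD] := hr _ (inb q s qt st).
rewrite E2 in E1.
rewrite -/(phi (t *: w + z)) -/(phi z) E1 mulrA -expr2 -mulrBr normrM.
rewrite (ger0_norm (sqr_ge0 t)) mulrC; apply: ler_wpM2r; first exact: sqr_ge0.
by rewrite distrC ltW.
Unshelve. all: by end_near. Qed.

(** The second difference is symmetric in [v] and [w]. *)
Lemma derive_sym (f : V -> R) z v w : smooth_at f z ->
  'D_v ('D_w f) z = 'D_w ('D_v f) z.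
Proof.
move=> sf; apply/eqP; rewrite -subr_eq0 -normr_le0; apply/ler_addgt0Pl => e e0.
rewrite addr0; have e2 : 0 < e / 2 by rewrite divr_gt0.
have d1 := second_difference v w sf e2.
have d2 := second_difference w v sf e2.
move: d1 => /nbhs_ballP[r1 /= r10 h1]; move: d2 => /nbhs_ballP[r2 /= r20 h2].
(* Any nonzero [t] in both neighbourhoods will do. *)
pose t := Num.min r1 r2 / 2.
have m0 : 0 < Num.min r1 r2 by rewrite lt_min r10 r20.
have tlt : `|t| < Num.min r1 r2.
  rewrite gtr0_norm ?divr_gt0 // ltr_pdivrMr // mulr_natr mulr2n.
  by rewrite ltrDl.
move: tlt; rewrite lt_min => /andP[tr1 tr2].
have t1 := h1 t; rewrite -ball_normE /= sub0r normrN in t1; move/(_ tr1): t1 => t1.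
have t2 := h2 t; rewrite -ball_normE /= sub0r normrN in t2; move/(_ tr2): t2 => t2.
have t0 : t != 0 by rewrite gt_eqF // divr_gt0.
have tt : 0 < t ^+ 2 by rewrite exprn_even_gt0.
rewrite -(ler_pM2r tt) -[X in `|_| * X]gtr0_norm // -normrM.
have alg (a b c d A B s : R) :
    (A - B) * s = (a - b - (c - d) - s * B) - (a - c - (b - d) - s * A) by ring.
rewrite (alg (f (t *: v + (t *: w + z))) (f (t *: v + z)) (f (t *: w + z)) (f z)).
rewrite [t *: w + (t *: v + z)]addrCA in t2.
have fin (x y a : R) :
    `|x| <= e / 2 * a -> `|y| <= e / 2 * a -> `|y - x| <= e * a.
  move=> hx hy; rewrite (le_trans (ler_normB _ _)) //.
  by rewrite [e]splitr mulrDl lerD.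
exact: fin t1 t2.
Qed.

End Schwarz.

(** * Derivatives on products and Euler's relation *)

Section ProductRules.
Context {R : realType} {U V W : normedModType R}.

Lemma derive_fst (F : U -> V * W) a v : differentiable F a ->
  ('D_v F a).1 = 'D_v (fun x => (F x).1) a.
Proof.
move=> dF; have fl : linear (fst : V * W -> V) by [].
have [l lE] := fct_linear fl.
have lc : continuous l by rewrite lE => x; exact: cvg_fst.
have [_] := is_derive_linear lc (diff_derivable (v := v) dF).
by rewrite lE => <-.
Qed.

Lemma derive_snd (F : U -> V * W) a v : differentiable F a ->
  ('D_v F a).2 = 'D_v (fun x => (F x).2) a.
Proof.
move=> dF; have fl : linear (snd : V * W -> W) by [].
have [l lE] := fct_linear fl.
have lc : continuous l by rewrite lE => x; exact: cvg_snd.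
have [_] := is_derive_linear lc (diff_derivable (v := v) dF).
by rewrite lE => <-.
Qed.

(** The two difference quotients coincide, so that nothing has to be known
    about the regularity of [F].  Objects on [TM] can thus be differentiated
    vertically over the base point of a chart, where the bundle chart is the
    identity, without looking at neighbouring fibres. *)
Lemma derive_vertical (F : U * V -> W) a b v :
  'D_(0, v) F (a, b) = 'D_v (fun c => F (a, c)) b.
Proof.
rewrite /derive.
have -> // : (fun h : R => h^-1 *: ((F \o shift (a, b)) (h *: (0, v)) - F (a, b))) =
  (fun h : R => h^-1 *: (((fun c => F (a, c)) \o shift b) (h *: v) - F (a, b))).
apply/funext => h; congr (_ *: (F _ - _)).
by rewrite -[LHS]/(h *: 0 + a, h *: v + b) scaler0 add0r.
Qed.

End ProductRules.

Section DeriveSum.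
Context {R : realType} {V W : normedModType R}.
Context {cV : coordinates V} {cW : coordinates W}.

Lemma derive_sum_of_smooth (I : Type) (r : seq I) (F : I -> V -> W) a v :
  (forall i, smooth_at (F i) a) ->
  'D_v (fun x => \sum_(i <- r) F i x) a = \sum_(i <- r) 'D_v (F i) a.
Proof.
move=> sF; elim: r => [|i r IH].
  rewrite big_nil -[RHS](derive_cst (0 : W) a v); congr ('D__ _ _).
  by apply/funext => x; rewrite big_nil.
rewrite big_cons -IH.
have d1 : derivable (F i) a v by exact/diff_derivable/smooth_differentiable/sF.
have d2 : derivable (fun x => \sum_(j <- r) F j x) a v.
  by apply: diff_derivable; apply: smooth_differentiable; exact: smooth_sum.
have -> : (fun x => \sum_(j <- i :: r) F j x) =
    (F i + (fun x => \sum_(j <- r) F j x)).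
  by apply/funext => x; rewrite big_cons.
exact: deriveD d1 d2.
Qed.

End DeriveSum.

Section EulerReal.
Context {R : realType} {V : normedModType R} {cV : coordinates V}.

Lemma derive_mul (f g : V -> R) a v : smooth_at f a -> smooth_at g a ->
  'D_v (fun x => f x * g x) a = f a * 'D_v g a + 'D_v f a * g a.
Proof.
move=> sf sg.
by have [_] := diff_scale (smooth_differentiable sf) (smooth_differentiable sg); exact.
Qed.

Lemma derive_coef i (a v : V) : 'D_v (fun x => ccoef i x : R) a = ccoef i v.
Proof.
have [_ e] := is_derive_linear (@ccoef_continuous _ _ cV i) (@derivable_id _ _ a v).
by rewrite derive_id in e; exact: e.
Qed.

(** The derivatives of a homogeneous function of degree [k] are homogeneous of
    degree [k - 1].  Homogeneity is expressed by Euler's relation, which is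
    differentiated in the direction [v]. *)
Lemma euler_derive (phi : V -> R) (k : R) b v : smooth_at phi b ->
  (\forall c \near b, 'D_c phi c = k * phi c) ->
  'D_b ('D_v phi) b = (k - 1) * 'D_v phi b.
Proof.
move=> sp hom.
have sD i : smooth_at ('D_(cvec i) phi) b by exact: smooth_derive.
have sc i : smooth_at (fun x : V => ccoef i x : R) b.
  by apply: smooth_coef; exact: smooth_id.
have E1 : 'D_v (fun c => k * phi c) b = k * 'D_v phi b.
  by rewrite (derive_mul v (smooth_cst k b) sp) (derive_cst k b v) mul0r addr0.
have E2 : 'D_v (fun c => k * phi c) b =
    'D_v (fun c => \sum_i (ccoef i c : R) * 'D_(cvec i) phi c) b.
  apply: near_eq_derive; apply: filterS2 hom (smooth_near sp) => c <- sc'.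
  by rewrite (derive_coords cV _ (smooth_differentiable sc')).
have E3 : 'D_v (fun c => \sum_i (ccoef i c : R) * 'D_(cvec i) phi c) b =
    'D_b ('D_v phi) b + 'D_v phi b.
  have h := derive_sum_of_smooth (index_enum 'I_(@cdim _ _ cV)) v
    (fun i => smooth_mul (sc i) (sD i)).
  rewrite h {h}.
  rewrite (derive_coords cV b (smooth_differentiable (smooth_derive v sp))).
  rewrite [X in _ = _ + X](derive_coords cV v (smooth_differentiable sp)) -big_split.
  apply: eq_bigr => i _.
  rewrite (derive_mul v (sc i) (sD i)) (derive_coef i b v).
  by rewrite (derive_sym v (cvec i) sp).
by rewrite mulrBl mul1r -E1 E2 E3 addrK.
Qed.

End EulerReal.

(** * Changes of charts and their tangent maps *)

Section Transitions.
Context {R : realType} {n : nat} {M : smooth_manifold R n}.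
Local Notation E := 'rV[R]_n.
Implicit Types (x y q p m : M) (v a b : E) (z w : E * E).

(** Near a point of a chart every coordinate vector comes from a point of the
    manifold, which may be chosen in any given open set. *)
Lemma chart_near x m (O : set M) : open O -> O m -> dom x m ->
  \forall a \near chart x m, exists p, [/\ O p, dom x p & a = chart x p].
Proof.
move=> oO Om xm.
have n1 : nbhs (chart x m) (chart x @` dom x).
  by apply: open_nbhs_nbhs; split; [exact: chart_image_open|exists m].
have n2 : \forall a \near chart x m, O (chart_inv x a).
  apply: (chart_inv_continuous xm); rewrite chartK //.
  by apply: open_nbhs_nbhs.
apply: filterS2 n1 n2 => a [p xp <-]; rewrite chartK // => Op.
by exists p.
Qed.

Lemma transition_chart x y p : dom x p -> transition x y (chart x p) = chart y p.
Proof. by move=> xp; rewrite /transition /= chartK. Qed.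

(** The differential at [p] of the transition map from [chart x] to
    [chart y]. *)
Definition jac x y p v : E := 'D_v (transition x y) (chart x p).

Lemma transition_differentiable x y p : dom x p -> dom y p ->
  differentiable (transition x y) (chart x p).
Proof. by move=> xp yp; exact/smooth_differentiable/transition_smooth. Qed.

Lemma jac_id x p v : dom x p -> jac x x p v = v.
Proof.
move=> xp; rewrite /jac -[RHS](derive_id (chart x p) v); apply: near_eq_derive.
apply: filterS (chart_near (@openT M) I xp) => a [q [_ xq ->]].
by rewrite transition_chart.
Qed.

(** Functoriality, from the chain rule; with [jac_id] it shows that transition
    maps have invertible differentials. *)
Lemma jac_comp x q y p v : dom x p -> dom q p -> dom y p ->
  jac q y p (jac x q p v) = jac x y p v.
Proof.
move=> xp qp yp; rewrite /jac.
have dq := transition_differentiable qp yp.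
have dx := transition_differentiable xp qp.
rewrite -(transition_chart q xp) in dq *; rewrite -(derive_comp _ dx dq).
apply: near_eq_derive.
apply: filterS (chart_near (dom_open q) qp xp) => a [r [qr xr ->]].
by rewrite /= !transition_chart.
Qed.

Lemma jac_linear x y p c a b : dom x p -> dom y p ->
  jac x y p (c *: a + b) = c *: jac x y p a + jac x y p b.
Proof.
by move=> xp yp; rewrite /jac derive_linear_dir //; exact: transition_differentiable.
Qed.

Lemma jac0 x y p : dom x p -> dom y p -> jac x y p 0 = 0.
Proof. by move=> xp yp; rewrite /jac derive0. Qed.

Lemma tangent_image_near x p b : dom x p ->
  \forall z \near (chart x p, b), exists p b, dom x p /\ z = (chart x p, b).
Proof.
move=> xp.
have h : \forall a \near chart x p, exists q, [/\ True, dom x q & a = chart x q].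
  exact: (chart_near (@openT M) I xp).
exists ([set a | exists q, [/\ True, dom x q & a = chart x q]], setT) => /=.
  by split=> //; exact: filterT.
by move=> [a c] /= [[q [_ xq ->]] _]; exists q, c.
Qed.

Lemma fst_continuous_near x p b (P : set E) :
  (\forall a \near chart x p, P a) -> \forall z \near (chart x p, b), P z.1.
Proof.
move=> nP; exists (P, setT) => /=; first by split=> //; exact: filterT.
by move=> [a c] /= [].
Qed.

Lemma Tinv_chart x p b : dom x p -> Tinv x (chart x p, b) = (p, jac x p p b) :> TM M.
Proof. by move=> xp; rewrite /Tinv /= chartK. Qed.

Lemma Ttransition_chart x y p b : dom x p ->
  Ttransition x y (chart x p, b) = (chart y p, jac x y p b).
Proof. by move=> xp; rewrite /Ttransition /= transition_chart. Qed.

Lemma Tinv_here (u : TM M) : Tinv u.1 (here u) = u.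
Proof.
have d := mem_dom u.1.
by rewrite /here Tinv_chart // jac_id //; case: u d.
Qed.

Lemma smooth_Ttransition x y p b : dom x p -> dom y p ->
  smooth_at (Ttransition x y) (chart x p, b).
Proof.
move=> xp yp.
have s1 : smooth_at (fun z : E * E => z.1) (chart x p, b).
  by apply: smooth_fst; exact: smooth_id.
have s2 : smooth_at (fun z : E * E => z.2) (chart x p, b).
  by apply: smooth_snd; exact: smooth_id.
have st : smooth_at (transition x y) (chart x p) by exact: transition_smooth.
apply: smooth_pair; first exact: (smooth_comp s1 st).
exact: (smooth_derive_along s2 s1 st).
Qed.

Lemma Ttransition_differentiable x y p b : dom x p -> dom y p ->
  differentiable (Ttransition x y) (chart x p, b).
Proof. by move=> xp yp; exact/smooth_differentiable/smooth_Ttransition. Qed.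

(** The differential of a transition map of [TM]. *)
Definition Tjac x y z w : E * E := 'D_w (Ttransition x y) z.

Lemma Tjac_id x p b w : dom x p -> Tjac x x (chart x p, b) w = w.
Proof.
move=> xp; rewrite /Tjac -[RHS](derive_id (chart x p, b) w); apply: near_eq_derive.
apply: filterS (tangent_image_near b xp) => a [q [c [xq ->]]].
by rewrite Ttransition_chart // jac_id.
Qed.

Lemma Tjac_comp x q y p b w : dom x p -> dom q p -> dom y p ->
  Tjac q y (Ttransition x q (chart x p, b)) (Tjac x q (chart x p, b) w) =
  Tjac x y (chart x p, b) w.
Proof.
move=> xp qp yp; rewrite /Tjac.
have dx := Ttransition_differentiable b xp qp.
have dq := Ttransition_differentiable (jac x q p b) qp yp.
rewrite -(Ttransition_chart q b xp) in dq.
rewrite -(derive_comp _ dx dq); apply: near_eq_derive.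
apply: filterS (fst_continuous_near b (chart_near (openI (dom_open q) (dom_open y)) (conj qp yp) xp)).
move=> [a c] /= [r [[qr yr] xr ->]].
by rewrite /= !Ttransition_chart // jac_comp.
Qed.

Lemma Tjac_linear x y p b c w w' : dom x p -> dom y p ->
  Tjac x y (chart x p, b) (c *: w + w') =
  c *: Tjac x y (chart x p, b) w + Tjac x y (chart x p, b) w'.
Proof.
by move=> xp yp; rewrite /Tjac derive_linear_dir //; exact: Ttransition_differentiable.
Qed.

Lemma Tjac_fst x y p b w : dom x p -> dom y p ->
  (Tjac x y (chart x p, b) w).1 = jac x y p w.1.
Proof.
move=> xp yp; rewrite /Tjac derive_fst; last exact: Ttransition_differentiable.
have d1 : differentiable (fun z : E * E => z.1) (chart x p, b).
  by apply: smooth_differentiable; apply: smooth_fst; exact: smooth_id.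
have d2 := transition_differentiable xp yp.
rewrite [LHS](derive_comp w d1 d2) /jac; congr ('D__ _ _).
by rewrite -(derive_fst (F := id)) ?derive_id.
Qed.

(** On a fibre the transition map is the linear map [jac x y p]. *)
Lemma Tjac_vertical x y p b v : dom x p -> dom y p ->
  Tjac x y (chart x p, b) (0, v) = (0, jac x y p v).
Proof.
move=> xp yp; have h := Tjac_fst b (0, v) xp yp; rewrite jac0 // in h.
rewrite [LHS]surjective_pairing h; congr pair; rewrite /Tjac.
have dT := Ttransition_differentiable b xp yp.
have d2 : differentiable (fun z => (Ttransition x y z).2) (chart x p, b).
  by apply: smooth_differentiable; apply: smooth_snd; exact: smooth_Ttransition.
rewrite derive_snd // derive_vertical //=.
have dt := transition_differentiable xp yp.
have -> : (fun c => 'D_c (transition x y) (chart x p)) =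
    'd (transition x y) (chart x p).
  by apply/funext => c; rewrite deriveE.
rewrite deriveE; last exact/linear_differentiable/diff_continuous.
by rewrite diff_lin ?/jac ?deriveE //; exact: diff_continuous.
Qed.

End Transitions.

(** * Fields and their components *)

Section Fields.
Context {R : realType} {n : nat} {M : smooth_manifold R n}.
Local Notation E := 'rV[R]_n.
Implicit Types (x y q p m : M) (a b : E) (z w : E * E) (u : TM M).
Implicit Types (X Y Z : pifield M) (A B : vfield M).

(** Neighbourhoods of [u] are taken in the bundle chart over [chart u.1]: the
    product topology of the carrier of [TM], whose points use unrelated charts,
    is not that of the tangent bundle. *)
Definition around u (P : TM M -> Prop) : Prop :=
  \forall z \near here u, P (Tinv u.1 z).

Lemma around_self u P : around u P -> P u.
Proof. by move=> h; have := nbhs_singleton h; rewrite Tinv_here. Qed.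

Lemma aroundW u (P : TM M -> Prop) : (forall u', P u') -> around u P.
Proof.
by move=> h; exists (setT, setT) => [|z _]; [split; exact: filterT|exact: h].
Qed.

Lemma around_imply u (P Q : TM M -> Prop) :
  (forall u', P u' -> Q u') -> around u P -> around u Q.
Proof. by rewrite /around => h; apply: filterS => z; exact: h. Qed.

Lemma around_imply2 u (P Q S : TM M -> Prop) :
  (forall u', P u' -> Q u' -> S u') -> around u P -> around u Q -> around u S.
Proof. by rewrite /around => h; apply: filterS2 => z; exact: h. Qed.

Lemma here_near u : \forall z \near here u,
  exists p b, dom u.1 p /\ z = (chart u.1 p, b).
Proof. exact: tangent_image_near (mem_dom _). Qed.

(** A nonzero vector has nonzero components in every chart, transition maps
    having injective differentials. *)
Lemma around_slit u : slit u -> around u (@slit R n M).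
Proof.
move=> su; rewrite /around.
have n2 : \forall z \near here u, z.2 != 0.
  have s : smooth_at (fun z : E * E => z.2) (here u).
    by apply: smooth_snd; exact: smooth_id.
  have c : z.2 @[z --> here u] --> (here u).2 by exact: smooth_continuous s.
  exact: (cvgr_neq0 _ c su).
near=> z; have [p [b [xp zE]]] : exists p b, dom u.1 p /\ z = (chart u.1 p, b).
  by near: z; exact: here_near.
have : z.2 != 0 by near: z.
rewrite zE /= Tinv_chart // /slit /=; apply: contra_neq => J0.
by rewrite -(jac_id b xp) -(jac_comp b xp (mem_dom p) xp) J0 jac0 //; exact: mem_dom.
Unshelve. all: by end_near. Qed.

Lemma pirep_chart x p b X : dom x p ->
  pirep x X (chart x p, b) = jac p x p (X (p, jac x p p b)).
Proof. by move=> xp; rewrite /pirep Tinv_chart. Qed.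

Lemma vrep_chart x p b A : dom x p ->
  vrep x A (chart x p, b) = Tjac p x (chart p p, jac x p p b) (A (p, jac x p p b)).
Proof. by move=> xp; rewrite /vrep Tinv_chart. Qed.

(** Over the base point itself the chart [chart x] identifies nothing: the
    components of a field are its values. *)
Lemma pirep_fibre x b X : pirep x X (chart x x, b) = X (x, b).
Proof. by have d := mem_dom x; rewrite pirep_chart // !jac_id. Qed.

Lemma pirep_linear x p b c X Y : dom x p ->
  pirep x (fun u => c u *: X u + Y u) (chart x p, b) =
  c (p, jac x p p b) *: pirep x X (chart x p, b) + pirep x Y (chart x p, b).
Proof. by move=> xp; rewrite !pirep_chart // jac_linear //; exact: mem_dom. Qed.

Lemma pi_smooth_eq u X Y :
  around u (fun u' => X u' = Y u') -> pi_smooth u X -> pi_smooth u Y.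
Proof.
rewrite /around => XY sX; apply: (smooth_near_eq sX).
by apply: filterS XY => z h; rewrite /pirep h.
Qed.

Lemma v_smooth_eq u A B :
  around u (fun u' => A u' = B u') -> v_smooth u A -> v_smooth u B.
Proof.
rewrite /around => AB sA; apply: (smooth_near_eq sA).
by apply: filterS AB => z h; rewrite /vrep h.
Qed.

Lemma fun_smooth_eq u f g :
  around u (fun u' => f u' = g u') -> fun_smooth u f -> fun_smooth u g.
Proof.
by rewrite /around => fg sf; apply: (smooth_near_eq sf); apply: filterS fg => z /= ->.
Qed.

Lemma pi_smooth_linear u c X Y : fun_smooth u c -> pi_smooth u X ->
  pi_smooth u Y -> pi_smooth u (fun u => c u *: X u + Y u).
Proof.
move=> sc sX sY; apply: (smooth_near_eq (smooth_add (smooth_scale sc sX) sY)).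
apply: filterS (here_near u) => z [p [b [xp ->]]].
by rewrite (pirep_linear b c X Y xp) -(Tinv_chart b xp).
Qed.

Lemma fun_smooth_cst u (c : R) : fun_smooth u (fun=> c).
Proof. exact: smooth_cst. Qed.

Lemma pi_smooth0 u : pi_smooth u (fun=> 0).
Proof.
apply: (smooth_near_eq (smooth_cst 0 _)).
apply: filterS (here_near u) => z [p [b [xp ->]]].
by rewrite pirep_chart // jac0 //; exact: mem_dom.
Qed.

Lemma pi_smoothZ u (c : TM M -> R) X :
  fun_smooth u c -> pi_smooth u X -> pi_smooth u (fun u => c u *: X u).
Proof.
move=> sc sX; apply: (pi_smooth_eq _ (pi_smooth_linear sc sX (pi_smooth0 u))).
by apply: aroundW => z; rewrite addr0.
Qed.

Lemma pi_smoothD u X Y : pi_smooth u X -> pi_smooth u Y ->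
  pi_smooth u (fun u => X u + Y u).
Proof.
move=> sX sY; apply: (pi_smooth_eq _ (pi_smooth_linear (fun_smooth_cst u 1) sX sY)).
by apply: aroundW => z; rewrite scale1r.
Qed.

Lemma pi_smoothN u X : pi_smooth u X -> pi_smooth u (fun u => - X u).
Proof.
move=> sX; apply: (pi_smooth_eq _ (pi_smoothZ (fun_smooth_cst u (-1)) sX)).
by apply: aroundW => z; rewrite scaleN1r.
Qed.

Lemma pi_smoothB u X Y : pi_smooth u X -> pi_smooth u Y ->
  pi_smooth u (fun u => X u - Y u).
Proof. by move=> sX sY; exact: (pi_smoothD sX (pi_smoothN sY)). Qed.

Lemma pi_smooth_sum (I : Type) (s : seq I) u (F : I -> pifield M) :
  (forall i, pi_smooth u (F i)) -> pi_smooth u (fun u => \sum_(i <- s) F i u).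
Proof.
move=> sF; elim: s => [|i s IH].
  apply: (pi_smooth_eq _ (pi_smooth0 u)).
  by apply: aroundW => z; rewrite big_nil.
apply: (pi_smooth_eq _ (pi_smoothD (sF i) IH)).
by apply: aroundW => z; rewrite big_cons.
Qed.

Lemma pirep_eta x p b : dom x p -> pirep x eta (chart x p, b) = b.
Proof.
by move=> xp; rewrite pirep_chart // /eta /= jac_comp ?jac_id //; exact: mem_dom.
Qed.

Lemma pi_smooth_eta u : pi_smooth u eta.
Proof.
have s : smooth_at (fun z : E * E => z.2) (here u).
  by apply: smooth_snd; exact: smooth_id.
apply: (smooth_near_eq s).
by apply: filterS (here_near u) => z [p [b [xp ->]]]; rewrite pirep_eta.
Qed.

Lemma pirep_frame u p b i : dom u.1 p ->
  pirep u.1 (frame u i) (chart u.1 p, b) = delta_mx 0 i.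
Proof.
move=> xp; rewrite pirep_chart // /frame /= -/(jac _ _ _ _) jac_comp ?jac_id //.
exact: mem_dom.
Qed.

Lemma pi_smooth_frame u i : pi_smooth u (frame u i).
Proof.
apply: (smooth_near_eq (smooth_cst (delta_mx 0 i) _)).
by apply: filterS (here_near u) => z [p [b [xp ->]]]; rewrite pirep_frame.
Qed.

Lemma frame_self u i : frame u i u = delta_mx 0 i.
Proof. by rewrite /frame -/(jac _ _ _ _) jac_id //; exact: mem_dom. Qed.

(** Tensorial identities are stated for fields; this field takes a prescribed
    value at [u]. *)
Definition extend u (v : E) : pifield M := fun u' => \sum_i v 0 i *: frame u i u'.

Lemma pi_smooth_extend u v : pi_smooth u (extend u v).
Proof.
apply: pi_smooth_sum => i; apply: pi_smoothZ; first exact: fun_smooth_cst.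
exact: pi_smooth_frame.
Qed.

Lemma extend_self u v : extend u v u = v.
Proof.
rewrite /extend [RHS]row_sum_delta; apply: eq_bigr => i _.
by rewrite frame_self.
Qed.

(** Smoothness at [u] is tested in the chart attached to [u], so that smoothness
    at a nearby vector concerns another chart.  The two representations differ
    by the differential of a transition map composed with the transition map of
    [TM]. *)
Lemma pi_smooth_near u X : pi_smooth u X -> around u (fun u' => pi_smooth u' X).
Proof.
move=> sX; rewrite /around.
near=> z; have [p [b [xp zE]]] : exists p b, dom u.1 p /\ z = (chart u.1 p, b).
  by near: z; exact: here_near.
have sz : smooth_at (pirep u.1 X) z.
  by near: z; exact: (smooth_near sX).
set x := u.1 in xp sz zE *; rewrite zE in sz.
rewrite zE (Tinv_chart b xp); set c := jac x p p b.
rewrite /pi_smooth -[here (p, c)]/(chart p p, c) -[(p, c).1]/p.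
have pp := mem_dom p.
have bE : Ttransition p x (chart p p, c) = (chart x p, b).
  by rewrite Ttransition_chart // /c jac_comp // jac_id.
have sT : smooth_at (Ttransition p x) (chart p p, c) by exact: smooth_Ttransition.
have s1 : smooth_at (pirep x X \o Ttransition p x) (chart p p, c).
  by apply: smooth_comp => //; rewrite bE.
have s2 : smooth_at (fun z => (Ttransition p x z).1) (chart p p, c).
  exact: smooth_fst.
have s3 : smooth_at (transition x p) ((Ttransition p x (chart p p, c)).1).
  by rewrite bE; exact: transition_smooth.
have key r d : dom x r -> dom p r ->
    'D_((pirep x X \o Ttransition p x) (chart p r, d)) (transition x p)
      (Ttransition p x (chart p r, d)).1 = pirep p X (chart p r, d).
  move=> xr pr; have rr := mem_dom r.
  rewrite (pirep_chart d X pr) -[(_ \o _) _]/(pirep x X (Ttransition p x (chart p r, d))).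
  rewrite (Ttransition_chart x d pr) (pirep_chart _ X xr).
  rewrite -[(_, _).1]/(chart x r) -/(jac x p r _).
  by rewrite (jac_comp _ rr xr pr) (jac_comp _ pr xr rr).
apply: (smooth_near_eq (smooth_derive_along s1 s2 s3)).
apply: filterS (fst_continuous_near c (chart_near (dom_open x) xp pp)).
move=> [a d] [r [xr pr ar]]; change (a = chart p r) in ar; rewrite ar.
exact: key.
Unshelve. all: by end_near. Qed.

Lemma vrep_linear x p b c A B : dom x p ->
  vrep x (fun u => c *: A u + B u) (chart x p, b) =
  c *: vrep x A (chart x p, b) + vrep x B (chart x p, b).
Proof. by move=> xp; rewrite !vrep_chart // Tjac_linear //; exact: mem_dom. Qed.

Lemma vrep_rho x p b A : dom x p ->
  (vrep x A (chart x p, b)).1 = pirep x (rho A) (chart x p, b).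
Proof.
by move=> xp; rewrite vrep_chart // Tjac_fst ?pirep_chart //; exact: mem_dom.
Qed.

Lemma vrep_gamma x p b X : dom x p ->
  vrep x (gamma X) (chart x p, b) = (0, pirep x X (chart x p, b)).
Proof.
by move=> xp; rewrite vrep_chart // Tjac_vertical ?pirep_chart //; exact: mem_dom.
Qed.

Lemma v_smooth_gamma u X : pi_smooth u X -> v_smooth u (gamma X).
Proof.
move=> sX; apply: (smooth_near_eq (smooth_pair (smooth_cst (0 : E) _) sX)).
by apply: filterS (here_near u) => z [p [b [xp ->]]]; rewrite vrep_gamma.
Qed.

Lemma v_smoothB u A B : v_smooth u A -> v_smooth u B ->
  v_smooth u (fun u => A u - B u).
Proof.
move=> sA sB.
apply: (smooth_near_eq (smooth_add (smooth_scale (smooth_cst (-1 : R) _) sB) sA)).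
apply: filterS (here_near u) => z [p [b [xp ->]]].
have <- : (fun u => (-1 : R) *: B u + A u) = (fun u => A u - B u).
  by apply/funext => u'; rewrite scaleN1r addrC.
by rewrite (vrep_linear b (-1) B A xp).
Qed.

End Fields.

Local Opaque derive.

Section Realize.
Context {R : realType} {n : nat} {M : smooth_manifold R n}.
Local Notation E := 'rV[R]_n.
Implicit Types (x y p : M) (a b : E) (u : TM M).
Implicit Types (X Y Z : pifield M) (A B : vfield M).

Lemma jac_sum (I : Type) (r : seq I) x y p (c : I -> R) (F : I -> E) :
  dom x p -> dom y p ->
  jac x y p (\sum_(i <- r) c i *: F i) = \sum_(i <- r) c i *: jac x y p (F i).
Proof.
move=> xp yp; elim: r => [|i r IH]; first by rewrite !big_nil jac0.
by rewrite !big_cons (jac_linear _ _ _ xp yp) IH.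
Qed.

Lemma jac_inj x y p a b : dom x p -> dom y p -> jac x y p a = jac x y p b -> a = b.
Proof.
move=> xp yp /(congr1 (jac y x p)).
by rewrite !(jac_comp _ xp yp xp) !(jac_id _ xp).
Qed.

Lemma pair0_sum (I : Type) (r : seq I) (c : I -> R) (F : I -> E) :
  (0, \sum_(i <- r) c i *: F i) = \sum_(i <- r) c i *: (0, F i) :> E * E.
Proof.
elim: r => [|i r IH]; first by rewrite !big_nil.
rewrite !big_cons -IH; congr pair.
by rewrite -[RHS]/(c i *: 0 + 0) scaler0 addr0.
Qed.

Lemma pirep_inj x p b X Y : dom x p ->
  pirep x X (chart x p, b) = pirep x Y (chart x p, b) ->
  X (p, jac x p p b) = Y (p, jac x p p b).
Proof.
move=> xp; rewrite !pirep_chart // => /(congr1 (jac x p p)).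
by have pp := mem_dom p; rewrite !(jac_comp _ pp xp pp) !jac_id.
Qed.

Lemma Ttransition_here x p b : dom x p ->
  Ttransition p x (here ((p, jac x p p b) : TM M)) = (chart x p, b).
Proof.
move=> xp; have pp := mem_dom p.
by rewrite /here (Ttransition_chart x _ pp) (jac_comp _ xp pp xp) (jac_id _ xp).
Qed.

(** A field may be prescribed by its components in one chart. *)
Lemma pirep_of_rep x (s : E * E -> E) :
  exists X, forall p b, dom x p -> pirep x X (chart x p, b) = s (chart x p, b).
Proof.
exists (fun u => jac x u.1 u.1 (s (Ttransition u.1 x (here u)))) => p b xp.
have pp := mem_dom p.
rewrite (pirep_chart b _ xp).
change (jac p x p (jac x p p (s (Ttransition p x (here ((p, jac x p p b) : TM M)))))
  = s (chart x p, b)).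
by rewrite (Ttransition_here b xp) (jac_comp _ xp pp xp) (jac_id _ xp).
Qed.

Lemma vrep_of_rep x (s : E * E -> E * E) :
  exists A : vfield M, forall p b, dom x p -> vrep x A (chart x p, b) = s (chart x p, b).
Proof.
exists (fun u => Tjac x u.1 (Ttransition u.1 x (here u))
  (s (Ttransition u.1 x (here u)))) => p b xp.
have pp := mem_dom p.
rewrite (vrep_chart b _ xp).
change (Tjac p x (chart p p, jac x p p b)
  (Tjac x p (Ttransition p x (here ((p, jac x p p b) : TM M)))
    (s (Ttransition p x (here ((p, jac x p p b) : TM M))))) = s (chart x p, b)).
rewrite (Ttransition_here b xp) -(Ttransition_chart p b xp) (Tjac_comp b _ xp pp xp).
by rewrite (Tjac_id b _ xp).
Qed.

Lemma v_smooth_rep u A (s : E * E -> E * E) : smooth_at s (here u) ->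
  (forall p b, dom u.1 p -> vrep u.1 A (chart u.1 p, b) = s (chart u.1 p, b)) ->
  v_smooth u A.
Proof.
move=> ss rA; apply: (smooth_near_eq ss).
by apply: filterS (here_near u) => z [p [b [xp ->]]]; rewrite rA.
Qed.

Lemma pi_smooth_rep u X (s : E * E -> E) : smooth_at s (here u) ->
  (forall p b, dom u.1 p -> pirep u.1 X (chart u.1 p, b) = s (chart u.1 p, b)) ->
  pi_smooth u X.
Proof.
move=> ss rA; apply: (smooth_near_eq ss).
by apply: filterS (here_near u) => z [p [b [xp ->]]]; rewrite rA.
Qed.

End Realize.

(** * Lie brackets *)

Section Bracket.
Context {R : realType} {n : nat} {M : smooth_manifold R n}.
Local Notation E := 'rV[R]_n.
Implicit Types (u : TM M) (X Y Z : pifield M) (A B C : vfield M).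

Lemma bracket_anti A B u : bracket B A u = - bracket A B u.
Proof. by rewrite /bracket opprB. Qed.

(** Additivity requires smooth fields: the derivative of a sum is the sum of the
    derivatives when these exist, and the derivative in a direction is linear
    in it for differentiable functions. *)
Lemma bracketBl u A B C : v_smooth u A -> v_smooth u B -> v_smooth u C ->
  bracket (fun u => A u - B u) C u = bracket A C u - bracket B C u.
Proof.
move=> sA sB sC.
have E1 : \forall z \near here u,
    vrep u.1 A z - vrep u.1 B z = vrep u.1 (fun u => A u - B u) z.
  apply: filterS (here_near u) => z [p [b [xp ->]]].
  have <- : (fun u => (-1 : R) *: B u + A u) = (fun u => A u - B u).
    by apply/funext => u'; rewrite scaleN1r addrC.
  by rewrite (vrep_linear b (-1) B A xp) scaleN1r addrC.
have dA : differentiable (vrep u.1 A) (here u) by exact: smooth_differentiable sA.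
have dB : differentiable (vrep u.1 B) (here u) by exact: smooth_differentiable sB.
have dC : differentiable (vrep u.1 C) (here u) by exact: smooth_differentiable sC.
have E2 v : 'D_v (vrep u.1 (fun u => A u - B u)) (here u) =
    'D_v (vrep u.1 A) (here u) - 'D_v (vrep u.1 B) (here u).
  transitivity ('D_v (fun z => vrep u.1 A z - vrep u.1 B z) (here u)).
    by symmetry; exact: (near_eq_derive _ E1).
  exact: (deriveB (diff_derivable dA) (diff_derivable dB)).
have E3 : 'D_(A u - B u) (vrep u.1 C) (here u) =
    'D_(A u) (vrep u.1 C) (here u) - 'D_(B u) (vrep u.1 C) (here u).
  have -> : A u - B u = (-1 : R) *: B u + A u by rewrite scaleN1r addrC.
  by rewrite (derive_linear_dir _ _ _ dC) scaleN1r addrC.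
have alg (a b c d : E * E) : (a - b) - (c - d) = (a - c) - (b - d).
  by rewrite !opprB addrACA [in RHS]addrACA; congr (_ + _); rewrite addrC.
transitivity (('D_(A u) (vrep u.1 C) (here u) - 'D_(B u) (vrep u.1 C) (here u)) -
  ('D_(C u) (vrep u.1 A) (here u) - 'D_(C u) (vrep u.1 B) (here u))).
  by congr (_ - _); [exact: E3|exact: E2].
exact: alg.
Qed.

Lemma bracket_eq u A B A' B' :
  around u (fun u' => A u' = A' u') -> around u (fun u' => B u' = B' u') ->
  bracket A B u = bracket A' B' u.
Proof.
move=> hA hB; have hAu := around_self hA; have hBu := around_self hB.
have EA : {near here u, vrep u.1 A =1 vrep u.1 A'}.
  by move: hA; rewrite /around; apply: filterS => z h; rewrite /vrep h.
have EB : {near here u, vrep u.1 B =1 vrep u.1 B'}.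
  by move: hB; rewrite /around; apply: filterS => z h; rewrite /vrep h.
have dA v : 'D_v (vrep u.1 A) (here u) = 'D_v (vrep u.1 A') (here u).
  exact: near_eq_derive EA.
have dB v : 'D_v (vrep u.1 B) (here u) = 'D_v (vrep u.1 B') (here u).
  exact: near_eq_derive EB.
rewrite /bracket hAu hBu.
exact: (f_equal2 (fun a b : E * E => a - b) (dB (A' u)) (dA (B' u))).
Qed.

Lemma derive_vrep_fst u A v : v_smooth u A ->
  ('D_v (vrep u.1 A) (here u)).1 = 'D_v (pirep u.1 (rho A)) (here u).
Proof.
move=> sA; rewrite derive_fst; last exact: smooth_differentiable.
apply: near_eq_derive.
by apply: filterS (here_near u) => z [p [b [xp ->]]]; rewrite vrep_rho.
Qed.

Lemma derive_pirep0 u v : 'D_v (pirep u.1 (fun=> 0 : E) : E * E -> E) (here u) = 0.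
Proof.
transitivity ('D_v (cst 0 : E * E -> E) (here u)); last exact: derive_cst.
apply: near_eq_derive.
apply: filterS (here_near u) => z [p [b [xp ->]]].
by rewrite (pirep_chart b (fun=> 0) xp); apply: jac0 => //; exact: mem_dom.
Qed.

(** Vertical vectors act on components without a connection, since bundle
    charts are linear on fibres. *)
Definition vertical_derivative X Y u : E := 'D_(0, X u) (pirep u.1 Y) (here u).

Lemma vertical_derivative_local u X Y Z :
  around u (fun u' => Y u' = Z u') -> vertical_derivative X Y u = vertical_derivative X Z u.
Proof.
move=> YZ; have h : {near here u, pirep u.1 Y =1 pirep u.1 Z}.
  by move: YZ; rewrite /around; apply: filterS => z e; rewrite /pirep e.
exact: near_eq_derive h.
Qed.

(** The horizontal part of a vertical field vanishes, which leaves one of the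
    two terms of the bracket. *)
Lemma rho_bracket_gamma u X A : pi_smooth u X -> v_smooth u A ->
  (bracket (gamma X) A u).1 = vertical_derivative X (rho A) u.
Proof.
move=> sX sA.
have h1 := derive_vrep_fst (gamma X u) sA.
have h2 := derive_vrep_fst (A u) (v_smooth_gamma sX).
have h3 : 'D_(A u) (pirep u.1 (rho (gamma X))) (here u) = 0 := derive_pirep0 u (A u).
rewrite h3 in h2.
exact: etrans (f_equal2 (fun a b : E => a - b) h1 h2) (subr0 _).
Qed.

End Bracket.

(** * Linear connections and horizontal lifts *)

Section Connection.
Context {R : realType} {n : nat} {M : smooth_manifold R n}.
Local Notation E := 'rV[R]_n.
Variable D : linear_connection M.
Implicit Types (u : TM M) (w : E * E) (X Y Z : pifield M) (A B C : vfield M).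

Lemma cov0 u Y : slit u -> pi_smooth u Y -> cov D u 0 Y = 0.
Proof.
move=> su sY; have := cov_linear_dir D (-1) 0 0 su sY.
by rewrite scaler0 addr0 scaleN1r addNr.
Qed.

Lemma cov_dirD u w w' Y : slit u -> pi_smooth u Y ->
  cov D u (w + w') Y = cov D u w Y + cov D u w' Y.
Proof.
by move=> su sY; have := cov_linear_dir D 1 w w' su sY; rewrite !scale1r.
Qed.

Lemma cov_dirZ u c w Y : slit u -> pi_smooth u Y ->
  cov D u (c *: w) Y = c *: cov D u w Y.
Proof.
move=> su sY; have := cov_linear_dir D c w 0 su sY.
by rewrite cov0 // !addr0.
Qed.

Lemma cov_dirN u w Y : slit u -> pi_smooth u Y -> cov D u (- w) Y = - cov D u w Y.
Proof. by move=> su sY; rewrite -scaleN1r cov_dirZ // scaleN1r. Qed.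

Lemma cov_dirB u w w' Y : slit u -> pi_smooth u Y ->
  cov D u (w - w') Y = cov D u w Y - cov D u w' Y.
Proof. by move=> su sY; rewrite cov_dirD // cov_dirN. Qed.

Lemma cov_dir_sum (I : Type) (s : seq I) (c : I -> R) (F : I -> E * E) u Y :
  slit u -> pi_smooth u Y ->
  cov D u (\sum_(i <- s) c i *: F i) Y = \sum_(i <- s) c i *: cov D u (F i) Y.
Proof.
move=> su sY; elim: s => [|i s IH]; first by rewrite !big_nil cov0.
by rewrite !big_cons cov_dirD // cov_dirZ // IH.
Qed.

Lemma act_cst u w (c : R) : act u w (fun=> c) = 0.
Proof. by rewrite /act -[_ \o _]/(cst c) derive_cst. Qed.

(** The indicator function of the complement of the zero set of [Y] is constant
    near [u] and reproduces [Y] by multiplication; the Leibniz rule applied to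
    this product needs no cut-off function. *)
Lemma cov_near0 u w Y : slit u -> pi_smooth u Y ->
  around u (fun u' => Y u' = 0) -> cov D u w Y = 0.
Proof.
move=> su sY Y0.
(* The product [f * Y] is [Y] itself. *)
pose f (u' : TM M) : R := (Y u' != 0)%:R.
have fY : (fun u' => f u' *: Y u') = Y.
  apply/funext => u'; rewrite /f; have [->|_] := eqVneq (Y u') 0.
    by rewrite scaler0.
  by rewrite scale1r.
have sf : fun_smooth u f.
  apply: (fun_smooth_eq _ (fun_smooth_cst u 0)).
  by move: Y0; rewrite /around; apply: filterS => z h; rewrite /f h eqxx.
have := cov_Leibniz D w su sf sY; rewrite fY => ->.
by rewrite /f (around_self Y0) eqxx scaler0 add0r scale0r.
Qed.

Lemma cov_fieldN u w Y : slit u -> pi_smooth u Y ->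
  cov D u w (fun u => - Y u) = - cov D u w Y.
Proof.
move=> su sY; have -> : (fun u => - Y u) = (fun u => (-1 : R) *: Y u).
  by apply/funext => u'; rewrite scaleN1r.
rewrite (cov_Leibniz D w su (fun_smooth_cst u (-1)) sY).
by rewrite act_cst scale0r add0r scaleN1r.
Qed.

Lemma cov_fieldD u w Y Z : slit u -> pi_smooth u Y -> pi_smooth u Z ->
  cov D u w (fun u => Y u + Z u) = cov D u w Y + cov D u w Z.
Proof. by move=> su sY sZ; exact: cov_additive. Qed.

Lemma cov_fieldB u w Y Z : slit u -> pi_smooth u Y -> pi_smooth u Z ->
  cov D u w (fun u => Y u - Z u) = cov D u w Y - cov D u w Z.
Proof.
move=> su sY sZ; rewrite (cov_fieldD w su sY (pi_smoothN sZ)).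
by rewrite cov_fieldN.
Qed.

Lemma cov_local u w Y Z : slit u -> pi_smooth u Y ->
  around u (fun u' => Y u' = Z u') -> cov D u w Y = cov D u w Z.
Proof.
move=> su sY YZ; have sZ := pi_smooth_eq YZ sY.
apply/eqP; rewrite -subr_eq0 -(cov_fieldB w su sY sZ); apply/eqP.
apply: (cov_near0 w su (pi_smoothB sY sZ)).
by move: YZ; rewrite /around; apply: filterS => z ->; rewrite subrr.
Qed.

Lemma nabla_smooth u A Y : slit u -> v_smooth u A -> pi_smooth u Y ->
  pi_smooth u (nabla D A Y).
Proof. exact: cov_smooth. Qed.

Hypothesis rD : regular D.

Lemma betaP u X : slit u -> (beta D X u).1 = X u /\ defl D u (beta D X u) = 0.
Proof.
move=> su; have [ex _] := rD su.
have [w1 [w2 [wE w10 w2d]]] := ex (X u, 0).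
have : [set w : E * E | w.1 = X u /\ defl D u w = 0] w2.
  by split=> //; move/(congr1 fst): wE => /= ->; rewrite w10 add0r.
by move=> h; have := xgetI 0 h.
Qed.

Lemma rho_beta u X : slit u -> around u (fun u' => rho (beta D X) u' = X u').
Proof. by move=> su; apply: around_imply (around_slit su) => u' /(betaP X) []. Qed.

Lemma beta_unique u X w : slit u -> w.1 = X u -> defl D u w = 0 -> beta D X u = w.
Proof.
move=> su w1 wd; have [b1 bd] := betaP X su; have [_ inj] := rD su.
have se := pi_smooth_eta u.
apply/eqP; rewrite -subr_eq0; apply/eqP; apply: inj.
  by rewrite -[LHS]/((beta D X u).1 - w.1) b1 w1 subrr.
by rewrite /defl cov_dirB // -/(defl D u w) wd -/(defl D u _) bd subrr.
Qed.

(** Start from any smooth field [W] with horizontal part [X] and correct it by a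
    vertical field [G] so as to annihilate the deflection.  In the frame of the
    chart, the deflection of vertical vectors has a smooth matrix [V], which is
    invertible by regularity, so that the components of [G] are given by
    [invmx V]. *)
Lemma v_smooth_beta u X : slit u -> pi_smooth u X -> v_smooth u (beta D X).
Proof.
move=> su sX; pose x := u.1.
pose k j := nabla D (gamma (frame u j)) eta.
have sk j : pi_smooth u (k j).
  exact: (nabla_smooth su (v_smooth_gamma (pi_smooth_frame u j)) (pi_smooth_eta u)).
have [W WE] := vrep_of_rep x (fun z => (pirep x X z, 0 : E)).
have sW : v_smooth u W.
  exact: (v_smooth_rep (smooth_pair sX (smooth_cst (0 : E) (here u))) WE).
pose K := nabla D W eta.
have sK : pi_smooth u K := nabla_smooth su sW (pi_smooth_eta u).
pose V z : 'M[R]_n := \matrix_j pirep x (k j) z.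
have sV i j : smooth_at (fun z => V z i j) (here u).
  have h : smooth_at (fun z => pirep x (k i) z 0 j) (here u).
    exact: ((smooth_rowP _ _).1 (sk i) j).
  by apply: (smooth_ext h) => z; rewrite mxE.
have VE p b (g : E) : dom x p -> slit (p, jac x p p b) ->
    jac p x p (defl D (p, jac x p p b) (0, g)) = jac p x p g *m V (chart x p, b).
  move=> xp sp; have pp := mem_dom p.
  set c := jac p x p g; set u' : TM M := (p, jac x p p b).
  have g_entries : g = \sum_i c 0 i *: frame u i u'.
    transitivity (jac x p p c); first by rewrite /c (jac_comp _ pp xp pp) jac_id.
    by rewrite [in LHS](row_sum_delta c) (jac_sum _ _ _ xp pp).
  have se := pi_smooth_eta u'.
  rewrite /defl [in LHS]g_entries pair0_sum (cov_dir_sum _ _ _ sp se) (jac_sum _ _ _ pp xp).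
  rewrite mulmx_sum_row; apply: eq_bigr => i _; congr (_ *: _).
  by rewrite rowK (pirep_chart b _ xp).
have Vu : V (here u) \in unitmx.
  rewrite -row_free_unit; apply: inj_row_free => v vV.
  have xx := mem_dom x.
  have uE : u = (x, jac x x x u.2) by rewrite jac_id // /x; case: (u).
  have := VE x u.2 v xx; rewrite -uE => /(_ su).
  rewrite !(jac_id _ xx) vV => d0.
  by have [_ inj] := rD su; have := inj (0, v) erefl d0 => -[].
pose c z : E := pirep x K z *m invmx (V z).
have sc : smooth_at c (here u).
  apply/smooth_rowP => i.
  have h : smooth_at (fun z => \sum_j pirep x K z 0 j * invmx (V z) j i) (here u).
    apply: smooth_sum => j _; apply: smooth_mul; last exact: smooth_invmx.
    exact: ((smooth_rowP _ _).1 sK j).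
  by apply: (smooth_ext h) => z; rewrite mxE.
have nV : \forall z \near here u, V z \in unitmx.
  have cd : \det (V z) @[z --> here u] --> \det (V (here u)).
    exact: (smooth_continuous (smooth_det sV)).
  rewrite unitmxE unitfE in Vu.
  by apply: filterS (cvgr_neq0 _ cd Vu) => z; rewrite unitmxE unitfE.
have [G GE] := pirep_of_rep x c.
have sG : pi_smooth u G := pi_smooth_rep sc GE.
apply: (v_smooth_eq _ (v_smoothB sW (v_smooth_gamma sG))).
have := around_slit su; rewrite /around => nS.
apply: filterS3 (here_near u) nV nS => z [p [b [xp ->]]] Vz.
rewrite (Tinv_chart b xp) => sp; have pp := mem_dom p.
set u' : TM M := (p, jac x p p b).
have se := pi_smooth_eta u'.
symmetry; apply: beta_unique => //.
  transitivity (rho W u'); first by rewrite -[LHS]/((W u').1 - 0) subr0.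
  by apply: (pirep_inj xp); rewrite -(vrep_rho b W xp) (WE _ b xp).
rewrite /defl (cov_dirB _ _ sp se); apply/eqP; rewrite subr_eq0; apply/eqP.
apply: (jac_inj pp xp); rewrite [RHS](VE _ _ _ xp sp).
transitivity (pirep x K (chart x p, b)); first by rewrite (pirep_chart b _ xp).
transitivity (c (chart x p, b) *m V (chart x p, b)); first by rewrite /c mulmxKV.
by rewrite -(GE _ b xp) (pirep_chart b _ xp).
Qed.

(** The torsion [T] is the endomorphism measuring the discrepancy between the
    covariant and the flat derivatives along the fibre. *)
Lemma TtorE u X Y : slit u -> pi_smooth u X -> pi_smooth u Y ->
  Ttor D X Y u = cov D u (0, X u) Y - vertical_derivative X Y u.
Proof.
move=> su sX sY.
have rb := rho_beta Y su.
have sb := v_smooth_beta su sY.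
rewrite /Ttor /torsion /nabla -[gamma X u]/(0, X u).
have srb : pi_smooth u (rho (beta D Y)).
  apply: pi_smooth_eq sY.
  by move: rb; rewrite /around; apply: filterS => z ->.
rewrite (cov_local _ su srb rb).
rewrite -[rho (gamma X)]/(fun=> 0) (cov_near0 _ su (pi_smooth0 u)); last first.
  exact: aroundW.
rewrite subr0.
have h1 := rho_bracket_gamma sX sb.
have h2 := vertical_derivative_local X rb.
have h : rho (bracket (gamma X) (beta D Y)) u = vertical_derivative X Y u := etrans h1 h2.
by rewrite h.
Qed.

End Connection.

(** * The Finsler metric along a fibre *)

Section Fibre.
Context {R : realType} {n : nat} {M : smooth_manifold R n}.
Local Notation E := 'rV[R]_n.
Implicit Types (x : M) (a b c v w : E) (u : TM M) (X Y Z : pifield M).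

Lemma smooth_fibre (W : normedModType R) (cW : coordinates W) (F : E * E -> W) a b :
  smooth_at F (a, b) -> smooth_at (fun c => F (a, c)) b.
Proof.
move=> sF.
have s : smooth_at (fun c : E => (a, c)) b.
  by apply: smooth_pair; [exact: smooth_cst|exact: smooth_id].
exact: (smooth_comp s sF).
Qed.

Lemma derive_entries (f : E -> R) a v : differentiable f a ->
  'D_v f a = \sum_i v 0 i * 'D_(delta_mx 0 i) f a.
Proof. exact: (derive_coords (coordinates_row n)). Qed.

Lemma Tinv_fibre x c : Tinv x (chart x x, c) = (x, c) :> TM M.
Proof. exact: (Tinv_here (x, c)). Qed.

Lemma near_nonzero b : b != 0 -> \forall c \near b, c != 0.
Proof.
move=> b0; have h : c @[c --> b] --> b by exact: cvg_id.
exact: (cvgr_neq0 _ h b0).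
Qed.

Definition energy (L : TM M -> R) x c : R := L (x, c) ^+ 2.

(** Along a fibre the metric is a Hessian in the ordinary sense. *)
Lemma gmxE L x c i j : gmx L (x, c) i j =
  2^-1 * 'D_(delta_mx 0 i) ('D_(delta_mx 0 j) (energy L x)) c.
Proof.
rewrite mxE; apply: (f_equal (fun r : R => 2^-1 * r)).
pose F : E * E -> R := (fun u' => L u' ^+ 2) \o Tinv x.
have EF : (fun d => F (chart x x, d)) = energy L x.
  by apply/funext => d; rewrite /F /= Tinv_fibre.
have h d : 'D_(0, delta_mx 0 j) F (chart x x, d) = 'D_(delta_mx 0 j) (energy L x) d.
  by rewrite -EF; exact: derive_vertical.
transitivity ('D_(delta_mx 0 i) (fun d => 'D_(0, delta_mx 0 j) F (chart x x, d)) c).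
  exact: derive_vertical.
by rewrite (funext h).
Qed.

Lemma g_entries L u v w : g L u v w = \sum_i \sum_j v 0 i * (w 0 j * gmx L u i j).
Proof.
rewrite /g mxE; under eq_bigr do rewrite mxE mulr_suml.
rewrite exchange_big; apply: eq_bigr => i _; apply: eq_bigr => j _.
by rewrite [w^T _ _]mxE -mulrA [gmx _ _ _ _ * _]mulrC.
Qed.

Lemma g_linearl L u k v v' w : g L u (k *: v + v') w = k * g L u v w + g L u v' w.
Proof. by rewrite /g !mulmxDl -!scalemxAl !mxE. Qed.

Lemma g_linearr L u k v w w' : g L u v (k *: w + w') = k * g L u v w + g L u v w'.
Proof. by rewrite /g linearP /= mulmxDr -scalemxAr !mxE. Qed.

Lemma gZl L u k v w : g L u (k *: v) w = k * g L u v w.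
Proof. by rewrite /g -!scalemxAl mxE. Qed.

Lemma gBl L u v v' w : g L u (v - v') w = g L u v w - g L u v' w.
Proof. by rewrite addrC -scaleN1r g_linearl mulN1r addrC. Qed.

Lemma gBr L u v w w' : g L u v (w - w') = g L u v w - g L u v w'.
Proof. by rewrite addrC -scaleN1r g_linearr mulN1r addrC. Qed.

Variables (L : TM M -> R) (hL : finsler L).

Lemma smooth_norm x c : c != 0 -> smooth_at (fun c => L (x, c)) c.
Proof.
move=> c0; have s := finsler_smooth hL (c0 : slit ((x, c) : TM M)).
apply: (smooth_ext (smooth_fibre _ s)) => d.
by rewrite /= Tinv_fibre.
Qed.

Lemma smooth_energy x c : c != 0 -> smooth_at (energy L x) c.
Proof.
move=> c0; have s := smooth_norm x c0.
by apply: (smooth_ext (smooth_mul s s)) => d; rewrite /energy expr2.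
Qed.

Lemma energy_homogeneous x c : c != 0 -> 'D_c (energy L x) c = 2 * energy L x c.
Proof.
move=> c0; have s := smooth_norm x c0.
have h := finsler_homogeneous hL (c0 : slit ((x, c) : TM M)).
have hc : 'D_c (fun c => L (x, c)) c = L (x, c).
  have EF : (fun d => (L \o Tinv x) (chart x x, d)) = (fun d => L (x, d)).
    by apply/funext => d; rewrite /= Tinv_fibre.
  by rewrite -[RHS]h -EF; symmetry; exact: derive_vertical.
have -> : energy L x = (fun d => L (x, d) * L (x, d)).
  by apply/funext => d; rewrite /energy expr2.
by rewrite derive_mul // hc; ring.
Qed.

Lemma smooth_gmx x b i j : b != 0 -> smooth_at (fun c => gmx L (x, c) i j) b.
Proof.
move=> b0.
have s : smooth_at (fun c => 2^-1 *
    'D_(delta_mx 0 i) ('D_(delta_mx 0 j) (energy L x)) c) b.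
  apply: smooth_mul; first exact: smooth_cst.
  by apply: smooth_derive; apply: smooth_derive; exact: smooth_energy.
by apply: (smooth_ext s) => c; rewrite gmxE.
Qed.

Lemma derive_entry (y : E -> E) a b i : smooth_at y b ->
  'D_a (fun c => y c 0 i) b = ('D_a y b) 0 i.
Proof.
move=> sy.
have fl : linear (fun v : E => v 0 i : R^o) by move=> k u v; rewrite !mxE.
have [l lE] := fct_linear fl.
have lc : continuous l by rewrite lE; exact: coord_continuous.
have [_] := is_derive_linear lc (diff_derivable (v := a) (smooth_differentiable sy)).
by rewrite lE => <-.
Qed.

Lemma derive_g x a b (y z : E -> E) : b != 0 -> smooth_at y b -> smooth_at z b ->
  'D_a (fun c => g L (x, c) (y c) (z c)) b =
  g L (x, b) ('D_a y b) (z b) + g L (x, b) (y b) ('D_a z b)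
  + \sum_i \sum_j y b 0 i * (z b 0 j * 'D_a (fun c => gmx L (x, c) i j) b).
Proof.
move=> b0 sy sz.
have syi i : smooth_at (fun c => y c 0 i) b by exact: ((smooth_rowP _ _).1 sy i).
have szi i : smooth_at (fun c => z c 0 i) b by exact: ((smooth_rowP _ _).1 sz i).
have sG i j := smooth_gmx x i j b0.
have s2 i j : smooth_at (fun c => z c 0 j * gmx L (x, c) i j) b.
  exact: smooth_mul (szi j) (sG i j).
have s3 i j : smooth_at (fun c => y c 0 i * (z c 0 j * gmx L (x, c) i j)) b.
  exact: smooth_mul (syi i) (s2 i j).
have s4 i : smooth_at (fun c => \sum_j y c 0 i * (z c 0 j * gmx L (x, c) i j)) b.
  by apply: smooth_sum => j _; exact: s3.
have -> : (fun c => g L (x, c) (y c) (z c)) =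
    (fun c => \sum_i \sum_j y c 0 i * (z c 0 j * gmx L (x, c) i j)).
  by apply/funext => c; rewrite g_entries.
rewrite (derive_sum_of_smooth _ _ s4) !g_entries -!big_split; apply: eq_bigr => i _.
rewrite /= (derive_sum_of_smooth _ _ (s3 i)) -!big_split; apply: eq_bigr => j _.
rewrite /= (derive_mul _ (syi i) (s2 i j)) (derive_mul _ (szi j) (sG i j)).
by rewrite !derive_entry //; ring.
Qed.

Lemma derive_g_const x a b v w : b != 0 ->
  'D_a (fun c => g L (x, c) v w) b =
  \sum_i \sum_j v 0 i * (w 0 j * 'D_a (fun c => gmx L (x, c) i j) b).
Proof.
move=> b0; have := derive_g x a b0 (smooth_cst v b) (smooth_cst w b).
rewrite !derive_cst => ->.
by rewrite /g mul0mx trmx0 mulmx0 mul0mx mxE !add0r.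
Qed.

(** The Hessian without coordinates, to which Euler's relation and the symmetry
    of derivatives apply directly. *)
Lemma g_hessian x c v w : c != 0 ->
  g L (x, c) v w = 2^-1 * 'D_v ('D_w (energy L x)) c.
Proof.
move=> c0; have s := smooth_energy x c0.
have E1 : {near c, 'D_w (energy L x) =1
    (fun d => \sum_j (w 0 j) * 'D_(delta_mx 0 j) (energy L x) d)}.
  apply: filterS (smooth_near s) => d sd.
  exact: (derive_entries _ (smooth_differentiable sd)).
have sj j : smooth_at ('D_(delta_mx 0 j) (energy L x)) c by exact: smooth_derive.
have s1 j : smooth_at (fun d => w 0 j * 'D_(delta_mx 0 j) (energy L x) d) c.
  exact: smooth_mul (smooth_cst _ _) (sj j).
rewrite (near_eq_derive _ E1) (derive_sum_of_smooth _ _ s1) g_entries exchange_big mulr_sumr.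
apply: eq_bigr => j _.
rewrite (derive_mul v (smooth_cst (w 0 j) c) (sj j)) (derive_cst (w 0 j) c v).
rewrite mul0r addr0.
rewrite (derive_entries v (smooth_differentiable (sj j))) !mulr_sumr.
by apply: eq_bigr => i _; rewrite gmxE; ring.
Qed.

Lemma g_sym x c v w : c != 0 -> g L (x, c) v w = g L (x, c) w v.
Proof.
move=> c0; have e := derive_sym v w (smooth_energy x c0).
have h := g_hessian x w v c0; rewrite -e in h.
exact: etrans (g_hessian x v w c0) (esym h).
Qed.

(** Euler's relation twice: [D_b D_b (L ^ 2) = D_b (L ^ 2) = 2 L ^ 2] at [b]. *)
Lemma g_eta u : slit u -> g L u u.2 u.2 = L u ^+ 2.
Proof.
case: u => x b /= b0; rewrite g_hessian //.
have h : \forall c \near b, 'D_c (energy L x) c = 2 * energy L x c.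
  by apply: filterS (near_nonzero b0) => c; exact: energy_homogeneous.
rewrite (euler_derive _ (smooth_energy x b0) h) energy_homogeneous //.
have -> : (2 - 1 : R) = 1 by ring.
by rewrite mul1r mulrA mulVf ?mul1r // pnatr_eq0.
Qed.

(** With [b] kept fixed, [g (v, b)] is half of [D_b D_v (L ^ 2)].  By symmetry,
    its derivative along [a] at [b] is half the radial derivative of
    [D_a D_v (L ^ 2)], which is homogeneous of degree zero. *)
Lemma derive_g_eta x a b v : b != 0 -> 'D_a (fun c => g L (x, c) v b) b = 0.
Proof.
move=> b0; have s := smooth_energy x b0.
have E1 : {near b, (fun c => g L (x, c) v b) =1
    (fun c => 2^-1 * 'D_b ('D_v (energy L x)) c)}.
  apply: filterS (near_nonzero b0) => c c0.
  by rewrite g_sym // g_hessian.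
rewrite (near_eq_derive _ E1) derive_mul; [|exact: smooth_cst|]; last first.
  by apply: smooth_derive; exact: smooth_derive.
rewrite derive_cst mul0r addr0.
have h1 : \forall c \near b, 'D_c ('D_v (energy L x)) c = 1 * 'D_v (energy L x) c.
  apply: filterS (near_nonzero b0) => c c0.
  have h : \forall d \near c, 'D_d (energy L x) d = 2 * energy L x d.
    by apply: filterS (near_nonzero c0) => d; exact: energy_homogeneous.
  by rewrite (euler_derive _ (smooth_energy x c0) h); congr (_ * _); ring.
rewrite (derive_sym _ _ (smooth_derive v s)) (euler_derive _ (smooth_derive v s) h1).
by rewrite subrr mul0r mulr0.
Qed.

End Fibre.

(** * Vertical derivatives for the Cartan connection *)

Section VerticalCartan.
Context {R : realType} {n : nat} {M : smooth_manifold R n}.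
Local Notation E := 'rV[R]_n.
Implicit Types (x : M) (a b c v w : E) (u : TM M) (X Y Z : pifield M).
Implicit Types (L : TM M -> R) (D : linear_connection M).

Lemma act_fibre x b a f : act ((x, b) : TM M) (0, a) f = 'D_a (fun c => f (x, c)) b.
Proof.
have EF : (fun d => (f \o Tinv x) (chart x x, d)) = (fun d => f (x, d)).
  by apply/funext => d; rewrite /= Tinv_fibre.
by rewrite -EF; exact: derive_vertical.
Qed.

Lemma derive_pirep_fibre x b a Y :
  'D_(0, a) (pirep x Y) (chart x x, b) = 'D_a (fun c => Y (x, c)) b.
Proof.
have EF : (fun d => pirep x Y (chart x x, d)) = (fun d => Y (x, d)).
  by apply/funext => d; rewrite pirep_fibre.
by rewrite -EF; exact: derive_vertical.
Qed.

Lemma pi_smooth_fibre x b Y : pi_smooth (x, b) Y -> smooth_at (fun c => Y (x, c)) b.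
Proof.
move=> sY; apply: (smooth_ext (smooth_fibre _ (sY : smooth_at _ (chart x x, b)))) => c.
exact: pirep_fibre.
Qed.

(** The value at [u] of the endomorphism [C_a]. *)
Definition vertical_form D u a Y : E :=
  cov D u (0, a) Y - 'D_(0, a) (pirep u.1 Y) (here u).

Lemma vertical_formE D x b a Y : vertical_form D (x, b) a Y =
  cov D (x, b) (0, a) Y - 'D_a (fun c => Y (x, c)) b.
Proof. by rewrite -derive_pirep_fibre. Qed.

(** Metricity along a vertical vector, the flat derivatives of [Y] and [Z] having
    been cancelled. *)
Lemma vertical_metric L D u a Y Z : finsler L -> cartan L D -> slit u ->
  pi_smooth u Y -> pi_smooth u Z ->
  'D_a (fun c => g L (u.1, c) (Y u) (Z u)) u.2 =
  g L u (vertical_form D u a Y) (Z u) + g L u (Y u) (vertical_form D u a Z).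
Proof.
case: u => x b hL hD su sY sZ.
have m := cartan_metric hD (0, a) su sY sZ; rewrite act_fibre in m.
rewrite (derive_g hL x a su (pi_smooth_fibre sY) (pi_smooth_fibre sZ)) in m.
rewrite -[(x, b).1]/x -[(x, b).2]/b (derive_g_const hL _ _ _ _ su) !vertical_formE.
rewrite gBl gBr; move: m; set s := \sum_i _; move: s.
set p := g L _ ('D_a _ _) _; set q := g L _ _ ('D_a _ _).
set p' := g L _ (cov _ _ _ _) _; set q' := g L _ _ (cov _ _ _ _).
by move=> s m; lra.
Qed.

Lemma vertical_symmetric L D u a Y Z : cartan L D -> slit u ->
  pi_smooth u Y -> pi_smooth u Z ->
  g L u (vertical_form D u a Y) (Z u) = g L u (vertical_form D u a Z) (Y u).
Proof.
move=> hD su sY sZ; have sa := pi_smooth_extend u a.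
have rD := cartan_regular hD.
have := cartan_T hD su sa sY sZ.
rewrite (TtorE rD su sa sY) (TtorE rD su sa sZ) /vertical_derivative extend_self.
exact.
Qed.

Lemma smooth_g_const L x b v w : finsler L -> b != 0 ->
  smooth_at (fun c => g L (x, c) v w) b.
Proof.
move=> hL b0.
have s : smooth_at (fun c => \sum_i \sum_j v 0 i * (w 0 j * gmx L (x, c) i j)) b.
  apply: smooth_sum => i _; apply: smooth_sum => j _.
  apply: smooth_mul; first exact: smooth_cst.
  by apply: smooth_mul; [exact: smooth_cst|exact: smooth_gmx].
by apply: (smooth_ext s) => c; rewrite g_entries.
Qed.

(** The difference [d Z] of the covariant derivatives satisfies
    [g (d Y, Z) + g (Y, d Z) = 0] by metricity and [g (d Y, Z) = g (d Z, Y)] by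
    the torsion axiom, the conformal factor being constant on the fibre.
    Choosing [Y] equal to [d Z] at [u] gives [2 g (d Z, d Z) = 0]. *)
Lemma vertical_cov_eq L L' D D' (s : R) u a Z :
  finsler L -> finsler L' -> cartan L D -> cartan L' D' -> s != 0 -> slit u ->
  (forall c v w, c != 0 -> g L' (u.1, c) v w = s * g L (u.1, c) v w) ->
  pi_smooth u Z -> cov D' u (0, a) Z = cov D u (0, a) Z.
Proof.
case: u => x b hL hL' hD hD' s0 su conf sZ; set u : TM M := (x, b).
have [d dcov] : exists d : pifield M -> E,
    forall Y, d Y = cov D' u (0, a) Y - cov D u (0, a) Y by eexists.
have dE Y : d Y = vertical_form D' u a Y - vertical_form D u a Y.
  by rewrite dcov /vertical_form opprB addrA subrK.
have conf' v w : g L' u v w = s * g L u v w by exact: conf.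
have alg1 (A A' P Q P' Q' P1 Q1 : R) : A = P + Q -> A' = P1 + Q1 ->
    A' = s * A -> P1 = s * P' -> Q1 = s * Q' -> (P' - P) + (Q' - Q) = 0.
  move=> -> -> + h1 h2; rewrite h1 h2 -mulrDr => /(mulfI s0) h.
  by rewrite addrACA -opprD h subrr.
have dmet Y : pi_smooth u Y -> g L u (d Y) (Z u) + g L u (Y u) (d Z) = 0.
  move=> sY; have m := vertical_metric a hL hD su sY sZ.
  have m' := vertical_metric a hL' hD' su sY sZ.
  have e : 'D_a (fun c => g L' (u.1, c) (Y u) (Z u)) u.2 =
      s * 'D_a (fun c => g L (u.1, c) (Y u) (Z u)) u.2.
    have h : {near b, (fun c => g L' (x, c) (Y u) (Z u)) =1
        (fun c => s * g L (x, c) (Y u) (Z u))}.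
      by apply: filterS (near_nonzero su) => c c0; exact: conf.
    transitivity ('D_a (fun c => s * g L (x, c) (Y u) (Z u)) b).
      exact: near_eq_derive h.
    have sg : smooth_at (fun c => g L (x, c) (Y u) (Z u)) b.
      exact: smooth_g_const.
    rewrite (derive_mul _ (smooth_cst s b) sg).
    by rewrite (derive_cst s b a) mul0r addr0.
  have c1 := conf' (vertical_form D' u a Y) (Z u).
  have c2 := conf' (Y u) (vertical_form D' u a Z).
  rewrite !dE gBl gBr; exact: (alg1 _ _ _ _ _ _ _ _ m m' e c1 c2).
have dsym Y : pi_smooth u Y -> g L u (d Y) (Z u) = g L u (d Z) (Y u).
  move=> sY; have t := vertical_symmetric a hD su sY sZ.
  have t' := vertical_symmetric a hD' su sY sZ.
  have c1 := conf' (vertical_form D' u a Y) (Z u).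
  have c2 := conf' (vertical_form D' u a Z) (Y u).
  have t1 := mulfI s0 (etrans (esym c1) (etrans t' c2)).
  rewrite (dE Y) (dE Z).
  move: (vertical_form D' u a Y) (vertical_form D u a Y) t t1 => p q.
  move: (vertical_form D' u a Z) (vertical_form D u a Z) => p' q' t t1.
  by rewrite !gBl t t1.
have sW := pi_smooth_extend u (d Z).
have h := dmet _ sW; rewrite (dsym _ sW) extend_self in h.
apply/eqP; rewrite -subr_eq0 -dcov; apply/negP => /negP dZ0.
have := finsler_posdef hL su dZ0; lra.
Qed.

(** With [C] the value of [C_a] on [eta], the argument of [vertical_cov_eq]
    applies since the derivative of [g (Y, eta)] along the fibre vanishes for
    fixed [Y] and [eta]: it yields [2 g (C, C) = 0]. *)
Lemma cov_vertical_eta L D u a : finsler L -> cartan L D -> slit u ->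
  cov D u (0, a) eta = a.
Proof.
case: u => x b hL hD su; set u : TM M := (x, b).
have se := pi_smooth_eta u.
set C := vertical_form D u a eta.
have sW := pi_smooth_extend u C.
have m := vertical_metric a hL hD su sW se.
have t := vertical_symmetric a hD su sW se.
rewrite (extend_self u C) in t.
rewrite (extend_self u C) (derive_g_eta hL _ _ _ su) in m.
have m2 : 0 = g L u C C + g L u C C.
  exact: etrans m (f_equal2 (fun a b : R => a + b) t erefl).
have C0 : C = 0.
  apply/eqP/negP => /negP dZ0.
  have := finsler_posdef hL su dZ0; lra.
move: C0; rewrite /C vertical_formE => /eqP; rewrite subr_eq0 => /eqP ->.
exact: derive_id.
Qed.

End VerticalCartan.

(** * Algebra of curvature and torsion *)

Section CurvatureTorsion.
Context {R : realType} {n : nat} {M : smooth_manifold R n}.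
Local Notation E := 'rV[R]_n.
Variable D : linear_connection M.
Implicit Types (u : TM M) (X Y Z : pifield M) (A B C U V W : vfield M).

Lemma pi_smooth_rho u A : v_smooth u A -> pi_smooth u (rho A).
Proof.
move=> sA; apply: (smooth_near_eq (smooth_fst sA)).
by apply: filterS (here_near u) => z [p [b [xp ->]]]; rewrite vrep_rho.
Qed.

Lemma nablaB_near u A B Z : slit u -> pi_smooth u Z ->
  around u (fun u' => nabla D (fun u => A u - B u) Z u' = nabla D A Z u' - nabla D B Z u').
Proof.
move=> su sZ; apply: around_imply2 (around_slit su) (pi_smooth_near sZ) => u' su' sZ'.
exact: cov_dirB.
Qed.

Lemma nabla_eq_near u A B Z : around u (fun u' => A u' = B u') ->
  around u (fun u' => nabla D A Z u' = nabla D B Z u').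
Proof. by apply: around_imply => u' h; rewrite /nabla h. Qed.

Lemma curvature_anti u U V Z : slit u -> pi_smooth u Z ->
  curvature D V U Z u = - curvature D U V Z u.
Proof.
move=> su sZ; have h : nabla D (bracket V U) Z u = - nabla D (bracket U V) Z u.
  by rewrite /nabla (bracket_anti U V u) (cov_dirN _ _ su sZ).
have alg (a b c : E) : - a + b + - c = - (- b + a + c).
  by apply/matrixP => i j; rewrite !mxE; ring.
apply: etrans (f_equal (fun c : E => _ + c) h) _.
exact: alg.
Qed.

Lemma curvatureBl u U A V Z : slit u -> pi_smooth u Z ->
  v_smooth u U -> v_smooth u A -> v_smooth u V ->
  curvature D (fun u => U u - A u) V Z u = curvature D U V Z u - curvature D A V Z u.
Proof.
move=> su sZ sU sA sV.
have sUZ := nabla_smooth D su sU sZ; have sAZ := nabla_smooth D su sA sZ.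
have sVZ := nabla_smooth D su sV sZ.
have h1 : nabla D (fun u => U u - A u) (nabla D V Z) u =
    nabla D U (nabla D V Z) u - nabla D A (nabla D V Z) u by exact: cov_dirB.
have h2 : nabla D V (nabla D (fun u => U u - A u) Z) u =
    nabla D V (nabla D U Z) u - nabla D V (nabla D A Z) u.
  have sd := pi_smoothB sUZ sAZ.
  have l := cov_local D (V u) su sd (around_imply (fun u' => @esym _ _ _) (nablaB_near U A su sZ)).
  rewrite [LHS](esym l); exact: cov_fieldB.
have h3 : nabla D (bracket (fun u => U u - A u) V) Z u =
    nabla D (bracket U V) Z u - nabla D (bracket A V) Z u.
  by rewrite /nabla (bracketBl sU sA sV); exact: cov_dirB.
have alg (a a' b b' c c' : E) :
    - (a - a') + (b - b') + (c - c') = (- a + b + c) - (- a' + b' + c').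
  by apply/matrixP => i j; rewrite !mxE; ring.
exact: etrans (f_equal3 (fun a b c : E => - a + b + c) h1 h2 h3) (alg _ _ _ _ _ _).
Qed.

Lemma curvatureBr u U V A Z : slit u -> pi_smooth u Z ->
  v_smooth u U -> v_smooth u V -> v_smooth u A ->
  curvature D U (fun u => V u - A u) Z u = curvature D U V Z u - curvature D U A Z u.
Proof.
move=> su sZ sU sV sA.
have h1 := curvature_anti (fun u => V u - A u) U su sZ.
have h2 := curvatureBl su sZ sV sA sU.
have h3 := curvature_anti U V su sZ; have h4 := curvature_anti U A su sZ.
have alg (a b : E) : - (- a - - b) = a - b by rewrite opprB opprK addrC.
refine (etrans h1 (etrans (f_equal (fun a : E => - a) (etrans h2
  (f_equal2 (fun a b : E => a - b) h3 h4))) _)).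
exact: alg.
Qed.

Lemma curvature_local u U U' V V' Z : slit u -> pi_smooth u Z ->
  v_smooth u U -> v_smooth u V ->
  around u (fun u' => U u' = U' u') -> around u (fun u' => V u' = V' u') ->
  curvature D U V Z u = curvature D U' V' Z u.
Proof.
move=> su sZ sU sV hU hV.
have sUZ := nabla_smooth D su sU sZ; have sVZ := nabla_smooth D su sV sZ.
have h1 : nabla D U (nabla D V Z) u = nabla D U' (nabla D V' Z) u.
  rewrite /nabla -(around_self hU).
  exact: (cov_local D (U u) su sVZ (nabla_eq_near Z hV)).
have h2 : nabla D V (nabla D U Z) u = nabla D V' (nabla D U' Z) u.
  rewrite /nabla -(around_self hV).
  exact: (cov_local D (V u) su sUZ (nabla_eq_near Z hU)).
have h3 : nabla D (bracket U V) Z u = nabla D (bracket U' V') Z u.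
  by rewrite /nabla (bracket_eq hU hV).
exact: (f_equal3 (fun a b c : E => - a + b + c) h1 h2 h3).
Qed.

Lemma torsion_anti u U V : torsion D V U u = - torsion D U V u.
Proof.
have e : rho (bracket V U) u = - rho (bracket U V) u.
  by rewrite /rho (bracket_anti U V u).
have alg (a b c : E) : a - b - - c = - (b - a - c).
  by apply/matrixP => i j; rewrite !mxE; ring.
apply: etrans (f_equal (fun c : E => _ - c) e) _.
exact: alg.
Qed.

Lemma torsionBl u U A V : slit u -> v_smooth u U -> v_smooth u A -> v_smooth u V ->
  torsion D (fun u => U u - A u) V u = torsion D U V u - torsion D A V u.
Proof.
move=> su sU sA sV; have sr := pi_smooth_rho sV.
have h1 : nabla D (fun u => U u - A u) (rho V) u =
    nabla D U (rho V) u - nabla D A (rho V) u by exact: cov_dirB.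
have h2 : nabla D V (rho (fun u => U u - A u)) u =
    nabla D V (rho U) u - nabla D V (rho A) u.
  exact: (cov_fieldB D (V u) su (pi_smooth_rho sU) (pi_smooth_rho sA)).
have h3 : rho (bracket (fun u => U u - A u) V) u =
    rho (bracket U V) u - rho (bracket A V) u.
  by rewrite /rho (bracketBl sU sA sV).
have alg (a a' b b' c c' : E) :
    (a - a') - (b - b') - (c - c') = (a - b - c) - (a' - b' - c').
  by apply/matrixP => i j; rewrite !mxE; ring.
exact: etrans (f_equal3 (fun a b c : E => a - b - c) h1 h2 h3) (alg _ _ _ _ _ _).
Qed.

Lemma torsionBr u U V A : slit u -> v_smooth u U -> v_smooth u V -> v_smooth u A ->
  torsion D U (fun u => V u - A u) u = torsion D U V u - torsion D U A u.
Proof.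
move=> su sU sV sA.
have h1 := torsion_anti u (fun u => V u - A u) U.
have h2 := torsionBl su sV sA sU.
have h3 := torsion_anti u U V; have h4 := torsion_anti u U A.
have alg (a b : E) : - (- a - - b) = a - b by rewrite opprB opprK addrC.
refine (etrans h1 (etrans (f_equal (fun a : E => - a) (etrans h2
  (f_equal2 (fun a b : E => a - b) h3 h4))) _)).
exact: alg.
Qed.

Lemma torsion_local u U U' V V' : slit u -> v_smooth u U -> v_smooth u V ->
  around u (fun u' => U u' = U' u') -> around u (fun u' => V u' = V' u') ->
  torsion D U V u = torsion D U' V' u.
Proof.
move=> su sU sV hU hV.
have rU : around u (fun u' => rho U u' = rho U' u').
  by apply: around_imply hU => u' h; rewrite /rho h.
have rV : around u (fun u' => rho V u' = rho V' u').
  by apply: around_imply hV => u' h; rewrite /rho h.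
have h1 : nabla D U (rho V) u = nabla D U' (rho V') u.
  rewrite /nabla -(around_self hU).
  exact: (cov_local D (U u) su (pi_smooth_rho sV) rV).
have h2 : nabla D V (rho U) u = nabla D V' (rho U') u.
  rewrite /nabla -(around_self hV).
  exact: (cov_local D (V u) su (pi_smooth_rho sU) rU).
have h3 : rho (bracket U V) u = rho (bracket U' V') u.
  by rewrite /rho (bracket_eq hU hV).
exact: (f_equal3 (fun a b c : E => a - b - c) h1 h2 h3).
Qed.

(** Fibres are integral submanifolds of the vertical distribution. *)
Lemma torsion_gamma u X Y : slit u -> pi_smooth u X -> pi_smooth u Y ->
  torsion D (gamma X) (gamma Y) u = 0.
Proof.
move=> su sX sY; rewrite /torsion.
have z w : cov D u w (fun=> 0) = 0.
  by apply: cov_near0 (pi_smooth0 u) _ => //; exact: aroundW.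
have h1 : nabla D (gamma X) (rho (gamma Y)) u = 0 by exact: z.
have h2 : nabla D (gamma Y) (rho (gamma X)) u = 0 by exact: z.
have h3 : rho (bracket (gamma X) (gamma Y)) u = 0.
  apply: etrans (rho_bracket_gamma sX (v_smooth_gamma sY)) _.
  exact: derive_pirep0.
apply: etrans (f_equal3 (fun a b c : E => a - b - c) h1 h2 h3) _.
by rewrite !subr0.
Qed.

End CurvatureTorsion.

(** * Difference of two connections *)

Section Compare.
Context {R : realType} {n : nat} {M : smooth_manifold R n}.
Local Notation E := 'rV[R]_n.
Variables D D' : linear_connection M.
Implicit Types (u : TM M) (w : E * E) (X Y Z : pifield M) (A B C U V W : vfield M).

Hypothesis rD : regular D.
Hypothesis rD' : regular D'.
Hypothesis vertical_eq : forall u a Z, slit u -> pi_smooth u Z ->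
  cov D' u (0, a) Z = cov D u (0, a) Z.
Hypothesis vertical_eta : forall u a, slit u -> cov D u (0, a) eta = a.

Local Notation B := (Bdiff D D').
Local Notation N := (Ndiff D D').

(** The two connections agree on vertical vectors, so that their difference
    depends on [w] only through its horizontal part [w.1], and may be computed
    on the lift of the latter. *)
Lemma cov_compare u w X Z : slit u -> pi_smooth u Z -> w.1 = X u ->
  cov D' u w Z = cov D u w Z + B X Z u.
Proof.
move=> su sZ w1; have [b1 _] := betaP rD X su.
have wE : w = beta D X u + (0, w.2 - (beta D X u).2).
  apply: etrans (surjective_pairing w) _.
  rewrite -[RHS]/((beta D X u).1 + 0, (beta D X u).2 + (w.2 - (beta D X u).2)).
  by rewrite addr0 b1 w1 subrKC.
rewrite wE !(cov_dirD _ _ _ su sZ) (vertical_eq _ su sZ).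
rewrite /Bdiff /omega /nabla; move: (cov D' u (beta D X u) Z) (cov D u _ Z) (cov D u (0, _) Z).
by move=> a b c; apply/matrixP => i j; rewrite !mxE; ring.
Qed.

Lemma Bdiff_val u X Y Z : X u = Y u -> B X Z u = B Y Z u.
Proof.
move=> XY; have e : beta D X u = beta D Y u by rewrite /beta XY.
by rewrite /Bdiff /omega /nabla e.
Qed.

Lemma Bdiff_subl u X Y X' Z : slit u -> pi_smooth u Z -> X' u = X u - Y u ->
  B X' Z u = B X Z u - B Y Z u.
Proof.
move=> su sZ XY.
have [b1 _] := betaP rD X su; have [b2 _] := betaP rD Y su.
have w1 : (beta D X u - beta D Y u).1 = X' u.
  by rewrite -[LHS]/((beta D X u).1 - (beta D Y u).1) b1 b2 XY.
have := cov_compare su sZ w1; rewrite !(cov_dirB _ _ _ su sZ).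
rewrite /(B X) /(B Y) /omega /nabla.
move: (cov D' u (beta D X u) Z) (cov D' u (beta D Y u) Z) (cov D u (beta D X u) Z).
move: (cov D u (beta D Y u) Z) (B X' Z u) => b c a' b' a /eqP.
rewrite -subr_eq0 => /eqP h; apply/eqP; rewrite -subr_eq0; apply/eqP.
rewrite -[RHS]oppr0 -h; apply/matrixP => i j; rewrite !mxE; ring.
Qed.

Lemma Bdiff_subr u X Y Z : slit u -> pi_smooth u Y -> pi_smooth u Z ->
  B X (fun u => Y u - Z u) u = B X Y u - B X Z u.
Proof.
move=> su sY sZ; rewrite /Bdiff /omega /nabla !(cov_fieldB _ _ su sY sZ).
by rewrite !opprD addrACA.
Qed.

Lemma Bdiff_local u X Y Z : slit u -> pi_smooth u Y ->
  around u (fun u' => Y u' = Z u') -> B X Y u = B X Z u.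
Proof.
move=> su sY YZ.
exact: (f_equal2 (fun a b : E => a - b) (cov_local D' _ su sY YZ) (cov_local D _ su sY YZ)).
Qed.

Lemma pi_smooth_Bdiff u X Z : slit u -> pi_smooth u X -> pi_smooth u Z ->
  pi_smooth u (B X Z).
Proof.
move=> su sX sZ; have sb := v_smooth_beta rD su sX.
exact: (pi_smoothB (nabla_smooth D' su sb sZ) (nabla_smooth D su sb sZ)).
Qed.

Lemma pi_smooth_Ndiff u X : slit u -> pi_smooth u X -> pi_smooth u (N X).
Proof. by move=> su sX; exact: (pi_smooth_Bdiff su sX (pi_smooth_eta u)). Qed.

(** The right-hand side has horizontal part [X], and its deflection for [D'] is
    [N X - N X], vertical deflections being trivial. *)
Lemma beta_compare u X : slit u -> beta D' X u = beta D X u - gamma (N X) u.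
Proof.
move=> su; have [b1 bd] := betaP rD X su; have se := pi_smooth_eta u.
apply: (beta_unique rD' su).
  by rewrite -[LHS]/((beta D X u).1 - 0) subr0.
rewrite /defl (cov_dirB _ _ _ su se) (vertical_eq _ su se) (vertical_eta _ su).
rewrite (cov_compare su se b1) -/(defl D u (beta D X u)) bd add0r.
by rewrite /Ndiff subrr.
Qed.

(** Second covariant derivatives for [D'] are expanded by [cov_compare].  The
    terms in [B (rho U, nabla_V Z)] and [B (rho V, nabla_U Z)] cancel by
    antisymmetry, and the derivatives of [rho U] and [rho V] left over from
    those of [B] combine with the bracket into the torsion. *)
Lemma curvature_compare u U V Z : slit u -> pi_smooth u Z ->
  v_smooth u U -> v_smooth u V ->
  curvature D' U V Z u = curvature D U V Z u
   - (nablaB D D' U (rho V) Z u + B (rho U) (B (rho V) Z) u)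
   + (nablaB D D' V (rho U) Z u + B (rho V) (B (rho U) Z) u)
   - B (torsion D U V) Z u.
Proof.
move=> su sZ sU sV.
have second A C : v_smooth u A -> v_smooth u C ->
    nabla D' A (nabla D' C Z) u = nabla D A (nabla D C Z) u
      + nabla D A (B (rho C) Z) u + B (rho A) (nabla D C Z) u
      + B (rho A) (B (rho C) Z) u.
  move=> sA sC.
  have sCZ := nabla_smooth D su sC sZ.
  have sBC := pi_smooth_Bdiff su (pi_smooth_rho sC) sZ.
  have germ : around u (fun u' => nabla D' C Z u' = nabla D C Z u' + B (rho C) Z u').
    apply: around_imply2 (around_slit su) (pi_smooth_near sZ) => u' su' sZ'.
    exact: cov_compare.
  have s' := nabla_smooth D' su sC sZ.
  have e1 := cov_local D' (A u) su s' germ.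
  have e2 := cov_fieldD D' (A u) su sCZ sBC.
  have e3 := cov_compare (w := A u) (X := rho A) su sCZ erefl.
  have e4 := cov_compare (w := A u) (X := rho A) su sBC erefl.
  have alg (a b c d : E) : (a + b) + (c + d) = a + c + b + d.
    by apply/matrixP => i j; rewrite !mxE; ring.
  apply: etrans e1 (etrans e2 (etrans (f_equal2 (fun a b : E => a + b) e3 e4) _)).
  exact: alg.
have e1 := second _ _ sU sV.
have e2 := second _ _ sV sU.
have e3 := cov_compare (w := bracket U V u) (X := rho (bracket U V)) su sZ erefl.
have t1 : B (torsion D U V) Z u = B (nabla D U (rho V)) Z u
    - B (nabla D V (rho U)) Z u - B (rho (bracket U V)) Z u.
  have h := @Bdiff_subl u (nabla D U (rho V)) (nabla D V (rho U))
    (fun u => nabla D U (rho V) u - nabla D V (rho U) u) Z su sZ erefl.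
  rewrite -h; exact: Bdiff_subl.
rewrite t1 /nablaB.
apply: etrans (f_equal3 (fun a b c : E => - a + b + c) e1 e2 e3) _.
rewrite /curvature -[nabla D (bracket U V) Z u]/(cov D u (bracket U V u) Z).
move: (nabla D U (nabla D V Z) u) (nabla D V (nabla D U Z) u) => k1 k2.
move: (cov D u (bracket U V u) Z) (B (rho (bracket U V)) Z u) => k3 k4.
move: (nabla D U (B (rho V) Z) u) (nabla D V (B (rho U) Z) u) => k5 k6.
move: (B (rho U) (nabla D V Z) u) (B (rho V) (nabla D U Z) u) => k7 k8.
move: (B (rho U) _ u) (B (rho V) _ u) => k9 k10.
move: (B (nabla D U (rho V)) Z u) (B (nabla D V (rho U)) Z u) => k11 k12.
by apply/matrixP => i j; rewrite !mxE; ring.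
Qed.

End Compare.

(** * Change of the horizontal curvature *)

Section CurvatureChange.
Context {R : realType} {n : nat} {M : smooth_manifold R n}.
Local Notation E := 'rV[R]_n.
Variables D D' : linear_connection M.
Implicit Types (u : TM M) (w : E * E) (X Y Z : pifield M) (A C U V W : vfield M).

Hypothesis rD : regular D.
Hypothesis rD' : regular D'.
Hypothesis vertical_eq : forall u a Z, slit u -> pi_smooth u Z ->
  cov D' u (0, a) Z = cov D u (0, a) Z.
Hypothesis vertical_eta : forall u a, slit u -> cov D u (0, a) eta = a.
Hypothesis torsion_free : forall u X Y, slit u -> pi_smooth u X -> pi_smooth u Y ->
  Qtor D X Y u = 0.

Local Notation B := (Bdiff D D').
Local Notation N := (Ndiff D D').
Local Notation Bsubl := (Bdiff_subl rD vertical_eq).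

Lemma nablaB_sub u W A C X Y Z : slit u -> pi_smooth u X -> pi_smooth u Z ->
  v_smooth u W -> v_smooth u A -> v_smooth u C ->
  around u (fun u' => W u' = A u' - C u') -> around u (fun u' => Y u' = X u') ->
  nablaB D D' W Y Z u = nablaB D D' A X Z u - nablaB D D' C X Z u.
Proof.
move=> su sX sZ sW sA sC hW hY.
have sY : pi_smooth u Y by apply: pi_smooth_eq sX; apply: around_imply hY.
have sBY := pi_smooth_Bdiff D' rD su sY sZ.
have sWZ := nabla_smooth D su sW sZ.
have sAZ := nabla_smooth D su sA sZ; have sCZ := nabla_smooth D su sC sZ.
have hB : around u (fun u' => B Y Z u' = B X Z u').
  by apply: around_imply hY => u'; exact: Bdiff_val.
have sBX := pi_smooth_eq hB sBY.
have split T : pi_smooth u T -> cov D u (W u) T = cov D u (A u) T - cov D u (C u) T.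
  by move=> sT; rewrite (around_self hW); exact: cov_dirB.
have e1 : nabla D W (B Y Z) u = nabla D A (B X Z) u - nabla D C (B X Z) u.
  exact: etrans (cov_local D (W u) su sBY hB) (split _ sBX).
have e2 : B (nabla D W Y) Z u = B (nabla D A X) Z u - B (nabla D C X) Z u.
  apply: (Bsubl su sZ).
  exact: etrans (cov_local D (W u) su sY hY) (split _ sX).
have e3 : B Y (nabla D W Z) u = B X (nabla D A Z) u - B X (nabla D C Z) u.
  have germ : around u (fun u' => nabla D W Z u' = nabla D A Z u' - nabla D C Z u').
    apply: around_imply2 (nabla_eq_near D Z hW) (nablaB_near D A C su sZ) => u' h1 h2.
    exact: etrans h1 h2.
  apply: etrans (Bdiff_val _ _ _ (around_self hY)) _.
  apply: etrans (Bdiff_local D D' X su sWZ germ) _.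
  exact: Bdiff_subr.
have alg (a a' b b' c c' : E) :
    (a - a') - (b - b') - (c - c') = (a - b - c) - (a' - b' - c').
  by apply/matrixP => i j; rewrite !mxE; ring.
exact: etrans (f_equal3 (fun a b c : E => a - b - c) e1 e2 e3) (alg _ _ _ _ _ _).
Qed.

(** The auxiliary operator in the definition of [H] is the vertical correction of
    the horizontal lift. *)
Lemma Ldiff_beta u X : slit u ->
  around u (fun u' => Ldiff D D' (beta D X) u' = gamma (N X) u').
Proof.
move=> su; apply: around_imply (rho_beta rD X su) => u' h.
by rewrite /Ldiff /gamma /Ndiff (Bdiff_val D D' eta h).
Qed.

(** [curvature_compare] is applied to the lifts for [D'], which are then replaced
    by [beta D X - gamma (N X)] and [beta D Y - gamma (N Y)]. The curvature of
    [D] splits into [R], [P] and [S]; the torsion reduces to the two mixed terms,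
    since [Q = 0] and there is no vertical torsion. *)
Lemma curvature_change u X Y Z : slit u ->
  pi_smooth u X -> pi_smooth u Y -> pi_smooth u Z ->
  Rcurv D' X Y Z u = Rcurv D X Y Z u + Hdiff D D' X Y Z u.
Proof.
move=> su sX sY sZ.
have sbX := v_smooth_beta rD su sX; have sbY := v_smooth_beta rD su sY.
have sU := v_smooth_beta rD' su sX; have sV := v_smooth_beta rD' su sY.
have sNX := pi_smooth_Ndiff D' rD su sX; have sNY := pi_smooth_Ndiff D' rD su sY.
have sgX := v_smooth_gamma sNX; have sgY := v_smooth_gamma sNY.
have germ T : around u (fun u' => beta D' T u' = beta D T u' - gamma (N T) u').
  by apply: around_imply (around_slit su) => u' su'; exact: beta_compare.
pose d T : vfield M := fun u => beta D T u - gamma (N T) u.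
have sdX : v_smooth u (d X) by exact: v_smoothB.
have sdY : v_smooth u (d Y) by exact: v_smoothB.
(* The curvature of [D] on the lifts for [D']: it is antisymmetric, so that
   the mixed term with the vertical entry first is [- P]. *)
have eK : curvature D (beta D' X) (beta D' Y) Z u =
    Rcurv D X Y Z u - Pcurv D X (N Y) Z u + Pcurv D Y (N X) Z u
    + Scurv D (N X) (N Y) Z u.
  have k1 : curvature D (beta D' X) (beta D' Y) Z u = curvature D (d X) (d Y) Z u.
    exact: (curvature_local D su sZ sU sV (germ X) (germ Y)).
  have k2 : curvature D (d X) (d Y) Z u =
      curvature D (beta D X) (d Y) Z u - curvature D (gamma (N X)) (d Y) Z u.
    exact: curvatureBl.
  refine (etrans k1 (etrans k2 _)).
  have r1 : curvature D (beta D X) (d Y) Z u = Rcurv D X Y Z u - Pcurv D X (N Y) Z u.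
    exact: (curvatureBr D su sZ sbX sbY sgY).
  have r2 : curvature D (gamma (N X)) (d Y) Z u =
      curvature D (gamma (N X)) (beta D Y) Z u - Scurv D (N X) (N Y) Z u.
    exact: (curvatureBr D su sZ sgX sbY sgY).
  have r3 : curvature D (gamma (N X)) (beta D Y) Z u = - Pcurv D Y (N X) Z u.
    exact: (curvature_anti D _ _ su sZ).
  have alg (r p p' s : E) : (r - p) - (- p' - s) = r - p + p' + s.
    by apply/matrixP => i j; rewrite !mxE; ring.
  rewrite r3 in r2.
  exact: etrans (f_equal2 (fun a b : E => a - b) r1 r2) (alg _ _ _ _).
have eT : torsion D (beta D' X) (beta D' Y) u = Ttor D (N Y) X u - Ttor D (N X) Y u.
  have k1 : torsion D (beta D' X) (beta D' Y) u = torsion D (d X) (d Y) u.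
    exact: (torsion_local D su sU sV (germ X) (germ Y)).
  have k2 : torsion D (d X) (d Y) u =
      torsion D (beta D X) (d Y) u - torsion D (gamma (N X)) (d Y) u.
    exact: torsionBl.
  refine (etrans k1 (etrans k2 _)).
  have r1 : torsion D (beta D X) (d Y) u = Qtor D X Y u - torsion D (beta D X) (gamma (N Y)) u.
    exact: (torsionBr D su sbX sbY sgY).
  have r2 : torsion D (gamma (N X)) (d Y) u =
      Ttor D (N X) Y u - torsion D (gamma (N X)) (gamma (N Y)) u.
    exact: (torsionBr D su sgX sbY sgY).
  have r3 : torsion D (beta D X) (gamma (N Y)) u = - Ttor D (N Y) X u.
    exact: torsion_anti.
  rewrite (torsion_free su sX sY) r3 sub0r opprK in r1.
  rewrite (torsion_gamma D su sNX sNY) subr0 in r2.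
  exact: (f_equal2 (fun a b : E => a - b) r1 r2).
have eB : B (torsion D (beta D' X) (beta D' Y)) Z u =
    B (Ttor D (N Y) X) Z u - B (Ttor D (N X) Y) Z u.
  exact: (Bsubl su sZ).
have eN S T : pi_smooth u S -> pi_smooth u T ->
    nablaB D D' (beta D' S) (rho (beta D' T)) Z u =
    nablaB D D' (beta D S) T Z u - nablaB D D' (Ldiff D D' (beta D S)) T Z u.
  move=> sS sT.
  have sL : v_smooth u (Ldiff D D' (beta D S)).
    have sr := pi_smooth_rho (v_smooth_beta rD su sS).
    exact: (v_smooth_gamma (pi_smooth_Ndiff D' rD su sr)).
  apply: (nablaB_sub su sT sZ (v_smooth_beta rD' su sS) (v_smooth_beta rD su sS) sL).
    by apply: around_imply2 (germ S) (Ldiff_beta S su) => u' h1 h2; rewrite h2.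
  exact: rho_beta.
have eBB S T : pi_smooth u S -> pi_smooth u T ->
    B (rho (beta D' S)) (B (rho (beta D' T)) Z) u = B S (B T Z) u.
  move=> sS sT.
  apply: etrans (Bdiff_val _ _ _ (around_self (rho_beta rD' S su))) _.
  have sr := pi_smooth_rho (v_smooth_beta rD' su sT).
  apply: (Bdiff_local D D' S su (pi_smooth_Bdiff D' rD su sr sZ)).
  by apply: around_imply (rho_beta rD' T su) => u'; exact: Bdiff_val.
have cmp := curvature_compare rD vertical_eq su sZ sU sV.
have combine (k k' m m' b b' l l' c c' t t' : E) : k = k' -> m = m' -> b = b' ->
    l = l' -> c = c' -> t = t' -> k - (m + b) + (l + c) - t = k' - (m' + b') + (l' + c') - t'.
  by move=> -> -> -> -> -> ->.
have alg (r p p' s a a1 c c1 b b' tX tY : E) :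
    r - p + p' + s - ((a - a1) + b) + ((c - c1) + b') - (tY - tX) =
    r + (s - ((p + a - a1 + b - tX) - (p' + c - c1 + b' - tY))).
  by apply/matrixP => i j; rewrite !mxE; ring.
refine (etrans cmp (etrans (combine _ _ _ _ _ _ _ _ _ _ _ _ eK (eN _ _ sX sY)
  (eBB _ _ sX sY) (eN _ _ sY sX) (eBB _ _ sY sX) eB) _)).
exact: alg.
Qed.

End CurvatureChange.

(** * Ricci tensors of conformal metrics *)

Section Ricci.
Context {R : realType} {n : nat} {M : smooth_manifold R n}.
Local Notation E := 'rV[R]_n.
Implicit Types (u : TM M) (X Y : pifield M).

(** When no value qualifies the choice is zero on both sides, which is compatible
    with scaling. *)
Lemma xget_scale (P P' : set E) (s : R) : s != 0 ->
  (forall w, P' w <-> P (s *: w)) -> (forall w w', P w -> P w' -> w = w') ->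
  xget 0 P' = s^-1 *: xget 0 P.
Proof.
move=> s0 PP' uniq.
have [[w Pw]|nP] := pselect (exists w, P w).
  have e1 : xget 0 P = w by apply: uniq => //; exact: (xgetI 0 Pw).
  have Pw' : P' (s^-1 *: w) by apply/PP'; rewrite scalerA divff // scale1r.
  have e2 : s *: xget 0 P' = w by apply: uniq => //; apply/PP'; exact: (xgetI 0 Pw').
  by rewrite e1 -e2 scalerA mulVf // scale1r.
have e1 : xget 0 P = 0 by apply: xgetPN => w Pw; apply: nP; exists w.
have e2 : xget 0 P' = 0.
  by apply: xgetPN => w /PP' Pw; apply: nP; exists (s *: w).
by rewrite e1 e2 scaler0.
Qed.

(** Raising an index with a metric scaled by [s] scales the result by
    [s^-1]; uniqueness of the operator is nondegeneracy of [g]. *)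
Lemma Ric0_conformal (L L' : TM M -> R) (D D' : linear_connection M) (s : R) u X :
  finsler L -> slit u -> pi_smooth u X -> s != 0 ->
  (forall v w, g L' u v w = s * g L u v w) ->
  (forall Y, pi_smooth u Y -> Ric D' X Y u = Ric D X Y u) ->
  Ric0 L' D' X u = s^-1 *: Ric0 L D X u.
Proof.
move=> hL su sX s0 conf hR.
pose P := [set w : E | forall Y, pi_smooth u Y -> g L u w (Y u) = Ric D X Y u].
pose P' := [set w : E | forall Y, pi_smooth u Y -> g L' u w (Y u) = Ric D' X Y u].
change (xget 0 P' = s^-1 *: xget 0 P).
have PP' w : P' w <-> P (s *: w).
  split=> h Y sY; have := h Y sY; rewrite gZl.
    by rewrite conf (hR _ sY).
  by rewrite conf (hR _ sY).
have uniq w w' : P w -> P w' -> w = w'.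
  move=> h h'; have sW := pi_smooth_extend u (w - w').
  have e : g L u (w - w') (w - w') = 0.
    by have := h _ sW; rewrite -(h' _ sW) extend_self gBl => ->; rewrite subrr.
  apply/eqP; rewrite -subr_eq0; apply/negP => /negP n0.
  by have := finsler_posdef hL su n0; rewrite e ltxx.
exact: (xget_scale s0 PP' uniq).
Qed.

End Ricci.

Theorem proposition4p8 (R : realType) (n : nat) (M : smooth_manifold R n)
    (L L' : TM M -> R) (D D' : linear_connection M) (sigma : M -> R)
    (hL : finsler L) (hL' : finsler L')
    (hD : cartan L D) (hD' : cartan L' D')
    (hsigma : base_smooth sigma)
    (hconf : forall (u : TM M) (v w : 'rV[R]_n), slit u ->
       g L' u v w = expR (2 * sigma u.1) * g L u v w)
    (hH : traceless_H D D') :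
  [/\ tensor_eq (Ric D') (Ric D),
      forall u : TM M, slit u -> L' u ^+ 2 * Sc L' D' u = L u ^+ 2 * Sc L D u,
      n <> 1%N -> tensor_eq (Ftens L' D') (Ftens L D)
    & tensor_eq (Etens L' D') (Etens L D)].
Proof.
have e0 (x : M) : expR (2 * sigma x) != 0 by rewrite gt_eqF // expR_gt0.
have vertical_eq u a Z : slit u -> pi_smooth u Z ->
    cov D' u (0, a) Z = cov D u (0, a) Z.
  move=> su sZ.
  apply: (vertical_cov_eq a hL hL' hD hD' (e0 u.1) su _ sZ) => c v w c0.
  exact: (hconf (u.1, c)).
have hRic : tensor_eq (Ric D') (Ric D).
  move=> u X Y su sX sY; apply/eqP; rewrite -subr_eq0 -(hH u X Y su sX sY).
  rewrite /Ric /Tr -sumrB; apply/eqP; apply: eq_bigr => i _.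
  have sF := pi_smooth_frame u i.
  rewrite (curvature_change (cartan_regular hD) (cartan_regular hD') vertical_eq
    (fun u a => cov_vertical_eta a hL hD) (cartan_Q hD) su sX sF sY).
  by rewrite mxE addrAC subrr add0r.
have hSc u : slit u -> Sc L' D' u = (expR (2 * sigma u.1))^-1 * Sc L D u.
  move=> su; rewrite /Sc /Tr mulr_sumr; apply: eq_bigr => i _.
  have sF := pi_smooth_frame u i.
  rewrite (Ric0_conformal (L := L) (D := D) hL su sF (e0 u.1)).
  - by rewrite mxE.
  - by move=> v w; exact: hconf.
  - by move=> Y sY; exact: hRic.
have cancel (s a b : R) : s != 0 -> (s^-1 * a) * (s * b) = a * b.
  by move=> s0; rewrite mulrACA mulVf // mul1r.
have hg u v w : slit u -> Sc L' D' u * g L' u v w = Sc L D u * g L u v w.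
  by move=> su; rewrite (hSc u su) (hconf u v w su) (cancel _ _ _ (e0 _)).
split=> [|u su|_ u X Y su sX sY|u X Y su sX sY]; first exact: hRic.
- have swap (a b c d e f : R) : e = a -> f = b -> c * e = d * f -> a * c = b * d.
    by move=> -> -> h; rewrite mulrC h mulrC.
  exact: (swap _ _ _ _ _ _ (g_eta hL' su) (g_eta hL su) (hg u u.2 u.2 su)).
- have r := hRic u X Y su sX sY; have h := hg u (X u) (Y u) su.
  exact: (f_equal2 (fun a b : R => a - b / (2 * (n%:R - 1))) r h).
- have r := hRic u X Y su sX sY; have h := hg u (X u) (Y u) su.
  have e (D0 : linear_connection M) (L0 : TM M -> R) : Etens L0 D0 X Y u =
      Ric D0 X Y u - Sc L0 D0 u * g L0 u (X u) (Y u) / 2.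
    by rewrite /Etens mulrAC.
  refine (etrans (e _ _) (etrans _ (esym (e _ _)))).
  exact: (f_equal2 (fun a b : R => a - b / 2) r h).
Qed.
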